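(* If $G$ is a $3$-chromatic $P_5$-free graph, then the reconfiguration graph $\mathcal{R}_k(G)$ is connected for each integer $k\geq 4$.
   Context: All graphs are finite and simple. $P_\ell$ denotes the path on $\ell$ vertices; a graph is $P_\ell$-free if it contains no induced subgraph isomorphic to $P_\ell$. A $k$-coloring of $G$ is a proper vertex coloring $\phi:V(G)\to\{1,\dots,k\}$, i.e. $\phi(u)\neq\phi(v)$ for adjacent $u,v$ (not all colors need be used). $G$ is $k$-chromatic if its chromatic number $\chi(G)$ equals $k$. The reconfiguration graph $\mathcal{R}_k(G)$ has as vertices all $k$-colorings of $G$, two $k$-colorings being joined by an edge if they differ in color on exactly one vertex of $G$. *)

(* Defs.v *)
From mathcomp Require Import all_boot.

Set Implicit Arguments.
Unset Strict Implicit.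
Unset Printing Implicit Defensive.

Record sgraph := SGraph {
  vertex :> finType;
  adj : rel vertex;
  adj_sym : symmetric adj;
  adj_irrefl : irreflexive adj }.

Definition isomorphic (G H : sgraph) : Prop :=
  exists2 f : G -> H, bijective f & forall x y, adj (f x) (f y) = adj x y.

Section Induced.
Variables (G : sgraph) (S : {set G}).

Definition induced_adj : rel {x : G | x \in S} :=
  fun x y => adj (val x) (val y).

Lemma induced_adj_sym : symmetric induced_adj.
Proof. by move=> x y; apply: adj_sym. Qed.

Lemma induced_adj_irrefl : irreflexive induced_adj.
Proof. by move=> x; apply: adj_irrefl. Qed.

Definition induced : sgraph := SGraph induced_adj_sym induced_adj_irrefl.

End Induced.

Section PathGraph.
Variable n : nat.

Definition path_adj : rel 'I_n := fun i j => (i.+1 == j) || (j.+1 == i).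

Lemma path_adj_sym : symmetric path_adj.
Proof. by move=> i j; rewrite /path_adj orbC. Qed.

Lemma path_adj_irrefl : irreflexive path_adj.
Proof. by move=> i; rewrite /path_adj orbb gtn_eqF. Qed.

(* The path on n vertices (not n edges). *)
Definition path_graph : sgraph := SGraph path_adj_sym path_adj_irrefl.

End PathGraph.

Definition path_free (n : nat) (G : sgraph) : Prop :=
  forall S : {set G}, ~ isomorphic (induced S) (path_graph n).

(* The colours are the elements 0, ..., k - 1 of 'I_k. *)
Definition proper_coloring (G : sgraph) (k : nat) (c : {ffun G -> 'I_k}) : bool :=
  [forall x, forall y, adj x y ==> (c x != c y)].

Definition coloring (G : sgraph) (k : nat) : finType :=
  {c : {ffun G -> 'I_k} | proper_coloring c}.

Definition colorable (G : sgraph) (k : nat) : bool :=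
  [exists c : {ffun G -> 'I_k}, proper_coloring c].

Lemma ex_colorable (G : sgraph) : exists k, colorable G k.
Proof.
exists #|G|; apply/existsP; exists [ffun x => enum_rank x].
apply/forallP => x; apply/forallP => y; apply/implyP => xy.
rewrite !ffunE (inj_eq enum_rank_inj).
by apply: contraTneq xy => ->; rewrite adj_irrefl.
Qed.

Definition chromatic_number (G : sgraph) : nat := ex_minn (ex_colorable G).

Section Reconfiguration.
Variables (G : sgraph) (k : nat).

Definition reconf_adj : rel (coloring G k) :=
  fun c d => #|[set x | val c x != val d x]| == 1.

Lemma reconf_adj_sym : symmetric reconf_adj.
Proof.
move=> c d; rewrite /reconf_adj; congr (_ == _).
by apply: eq_card => x; rewrite !inE eq_sym.
Qed.

Lemma reconf_adj_irrefl : irreflexive reconf_adj.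
Proof.
move=> c; rewrite /reconf_adj eq_card0 // => x.
by rewrite !inE eqxx.
Qed.

Definition reconf_graph : sgraph := SGraph reconf_adj_sym reconf_adj_irrefl.

End Reconfiguration.

(* The graph with no vertices is not considered connected. *)
Definition connected_graph (G : sgraph) : Prop :=
  0 < #|G| /\ forall x y : G, connect (@adj G) x y.

(* Main.v *)
Require Import Defs.
From mathcomp Require Import all_boot.

(** Suppose that some 3-colourable P5-free graph is not 4-mixing, and let G be
    one with the fewest vertices. A path of recolourings of a smaller graph
    lifts to G when the missing vertices can be moved out of the way. Hence G
    has no vertex whose neighbourhood is contained in that of another vertex,
    and no vertex of degree at most 2. It has no adjacent twins a, b either:
    their common neighbourhood N is constant in every 3-colouring, contracting
    N creates no induced P5, and the only obstruction to making N monochromatic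
    in a 4-colouring is a small subgraph that cannot be completed to G.
    With these restrictions, growing an induced subgraph vertex by vertex
    always ends in a contradiction, except for a prism and a graph on nine
    vertices, which would be components of G; in both, two nonadjacent vertices
    can always be given the same colour and then be contracted. For k > 4
    colours, freeze one colour class, bring the rest to a 3-colouring, and then
    move the frozen class to another colour, which leaves one colour unused. *)

Set Implicit Arguments.
Unset Strict Implicit.
Unset Printing Implicit Defensive.

(** * Recolouring sequences *)

Section Recoloring.
Variables (G : sgraph) (k : nat).
Implicit Types (c d : {ffun G -> 'I_k}) (u v w : G) (A : {set G}).

Lemma proper_coloringP c :
  reflect (forall u v, adj u v -> c u != c v) (proper_coloring c).
Proof.
apply: (iffP forallP) => [h u v uv | h u].
  by move/forallP/(_ v): (h u); rewrite uv.
by apply/forallP => v; apply/implyP; apply: h.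
Qed.

Definition recolor c A (x : 'I_k) : {ffun G -> 'I_k} :=
  [ffun w => if w \in A then x else c w].

(** The chosen vertex may keep its colour. Allowing such idle steps spares a case distinction
    whenever recolourings are lifted. *)
Definition step c d : bool :=
  [&& proper_coloring c, proper_coloring d
    & [exists v, d == recolor c [set v] (d v)]].

Definition reach c d : bool := connect step c d.

Definition mix : Prop :=
  forall c d, proper_coloring c -> proper_coloring d -> reach c d.

Lemma step_sym : symmetric step.
Proof.
suff h c d : step c d -> step d c by move=> c d; apply/idP/idP; apply: h.
case/and3P=> pc pd /existsP[v /eqP e]; apply/and3P; split=> //.
apply/existsP; exists v; apply/eqP/ffunP => w; rewrite ffunE inE.
case: eqP => [-> // | /eqP wv]; by rewrite e ffunE inE (negPf wv).
Qed.

Lemma reach_sym c d : reach c d = reach d c.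
Proof. exact: (sym_connect_sym step_sym). Qed.

Lemma reach_trans c d e : reach c d -> reach d e -> reach c e.
Proof. exact: connect_trans. Qed.

Lemma reach_proper c d : reach c d -> proper_coloring c -> proper_coloring d.
Proof.
case/connectP=> p; elim: p c => [|e p IH] c /=; first by move=> _ ->.
by case/andP=> /and3P[_ pe _] hp hd _; apply: (IH e).
Qed.

Lemma recolor_proper c A x : proper_coloring c ->
  (forall v w, v \in A -> adj v w -> (w \notin A) && (c w != x)) ->
  proper_coloring (recolor c A x).
Proof.
move=> /proper_coloringP pc h; apply/proper_coloringP => u v uv; rewrite !ffunE.
case: ifPn => uA; last case: ifPn => vA; last exact: pc.
  by case/andP: (h u v uA uv) => /negPf-> ; rewrite eq_sym.
by move: uv; rewrite adj_sym => /(h v u vA)/andP[].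
Qed.

(** The hypothesis makes [A] stable and keeps [x] off its neighbours. Every subset of [A] inherits
    this, so its vertices can be recoloured one at a time. *)
Lemma recolor_reach c A x : proper_coloring c ->
  (forall v w, v \in A -> adj v w -> (w \notin A) && (c w != x)) ->
  reach c (recolor c A x).
Proof.
move=> pc; move: {2}#|A| (erefl #|A|) => n.
elim: n A => [|n IH] A cA h.
  suff -> : recolor c A x = c by exact: connect0.
  by apply/ffunP => w; rewrite ffunE (cards0_eq cA) inE.
have /card_gt0P[v vA] : 0 < #|A| by rewrite cA.
have h' u w : u \in A :\ v -> adj u w -> (w \notin A :\ v) && (c w != x).
  rewrite !inE => /andP[_ uA] uw; case/andP: (h u w uA uw) => wA ->.
  by rewrite (negPf wA) andbF.
apply: reach_trans (IH (A :\ v) _ h') _.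
  by move: cA; rewrite (cardsD1 v) vA => -[].
apply/connect1/and3P; split; try exact: recolor_proper.
apply/existsP; exists v; apply/eqP/ffunP => w; rewrite !ffunE !inE vA.
by case: eqP => [-> |] //=; rewrite vA.
Qed.

Lemma recolor1_reach c v x : proper_coloring c ->
  (forall w, adj v w -> c w != x) -> reach c (recolor c [set v] x).
Proof.
move=> pc h; apply: recolor_reach => // u w /set1P-> vw; rewrite h // inE andbT.
by apply: contraTneq vw => ->; rewrite adj_irrefl.
Qed.

End Recoloring.

Lemma colorableP (G : sgraph) k :
  reflect (exists c : {ffun G -> 'I_k}, proper_coloring c) (colorable G k).
Proof. exact: existsP. Qed.

(** The common engine of all lifting arguments: if each single recolouring of [H] can be matched in
    [G] so as to preserve [R], induction along the sequence matches the whole sequence. *)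
Lemma reach_simulation (G H : sgraph) k k'
    (R : {ffun H -> 'I_k'} -> {ffun G -> 'I_k} -> Prop) :
  (forall c v x d, proper_coloring c -> proper_coloring (recolor c [set v] x) ->
    R c d -> exists2 d', reach d d' & R (recolor c [set v] x) d') ->
  forall c c' d, reach c c' -> R c d -> exists2 d', reach d d' & R c' d'.
Proof.
move=> sim c c' d /connectP[p]; elim: p c d => [|e p IH] c d /=.
  by move=> _ -> Rcd; exists d => //; apply: connect0.
case/andP=> /and3P[pc pe /existsP[v /eqP ev]] hp hl Rcd.
have [| d1 r1 R1] := sim c v (e v) d pc _ Rcd; first by rewrite -ev.
rewrite -ev in R1; have [d' r' R'] := IH e d1 hp hl R1.
by exists d' => //; apply: reach_trans r1 r'.
Qed.

(** Distinctness of the five vertices follows from the listed adjacencies and nonadjacencies. *)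
Definition p5free (G : sgraph) : Prop := forall a b c d e : G,
  adj a b -> adj b c -> adj c d -> adj d e ->
  ~~ adj a c -> ~~ adj a d -> ~~ adj a e ->
  ~~ adj b d -> ~~ adj b e -> ~~ adj c e -> False.

Section InducedSubgraph.
Variables (G : sgraph) (S : {set G}).

Lemma p5free_induced : p5free G -> p5free (induced S).
Proof. by move=> h a b c d e; apply: (h (val a) (val b) (val c) (val d)). Qed.

Lemma card_induced : #|induced S| = #|S|.
Proof. exact: card_sig. Qed.

Definition restrict k (c : {ffun G -> 'I_k}) : {ffun induced S -> 'I_k} :=
  [ffun u : induced S => c (val u)].

Lemma proper_restrict k (c : {ffun G -> 'I_k}) :
  proper_coloring c -> proper_coloring (restrict c).
Proof.
by move=> /proper_coloringP pc; apply/proper_coloringP => u v uv; rewrite !ffunE; apply: pc.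
Qed.

Lemma colorable_induced k : colorable G k -> colorable (induced S) k.
Proof.
move=> /colorableP[c pc]; apply/colorableP; exists (restrict c).
exact: proper_restrict.
Qed.

End InducedSubgraph.

(** * Minimal counterexamples *)

Definition minimal_nonmixing (G : sgraph) : Prop :=
  [/\ colorable G 3, p5free G, ~ mix G 4 &
    forall H : sgraph, #|H| < #|G| -> colorable H 3 -> p5free H -> mix H 4].

Section DeleteVertex.
Variables (G : sgraph) (k : nat) (u : G).
Let H := induced [set~ u].
Hypothesis mixH : mix H k.

Lemma in_del (w : G) : w != u -> w \in [set~ u].
Proof. by rewrite !inE. Qed.

(* [Q] is an invariant of the lifted colourings; the lifting of a recolouring
   of G - u may also move u. *)
Lemma mix_delete (Q : {ffun G -> 'I_k} -> Prop) :
  (forall c, proper_coloring c -> exists2 d, reach c d & Q d) ->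
  (forall c (v : G) x, v != u -> proper_coloring c -> Q c ->
    (forall w, w != u -> adj v w -> c w != x) ->
    exists2 d, reach c d & Q d /\ forall w, w != u -> d w = if w == v then x else c w) ->
  mix G k.
Proof.
move=> hQ sim c d pc pd.
have [c1 r1 Q1] := hQ c pc.
have pc1 := reach_proper r1 pc.
pose R (g : {ffun H -> 'I_k}) (e : {ffun G -> 'I_k}) :=
  [/\ proper_coloring e, Q e & forall x : H, g x = e (val x)].
have [||e r2 [pe _ eqe]] := @reach_simulation G H k k R _ _ _ c1
    (mixH (proper_restrict [set~ u] pc1) (proper_restrict [set~ u] pd)).
- move=> g v x e pg pg' [pe Qe eq_ge].
  have vu : val v != u by move: (valP v); rewrite !inE.
  have [| e' re [Qe' he']] := sim e (val v) x vu pe Qe.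
    move=> w wu vw.
    have [w' ww'] : exists w' : H, val w' = w by exists (Sub w (in_del wu)).
    have vw' : @adj H v w' by rewrite -ww' in vw.
    move/proper_coloringP/(_ v w' vw'): pg'; rewrite !ffunE set11 in_set1.
    case: ifP => [/eqP wv | _]; first by move: vw'; rewrite wv adj_irrefl.
    by rewrite eq_sym eq_ge ww'.
  exists e' => //; split=> //; first exact: reach_proper re pe.
  move=> y; rewrite he' ?ffunE ?inE ?(inj_eq val_inj) ?eq_ge //.
  by move: (valP y); rewrite !inE.
- by split=> // x; rewrite ffunE.
apply: reach_trans r1 (reach_trans r2 _).
(* The lifted colouring agrees with [d] away from [u], so one last recolouring of [u] finishes. *)
have -> : d = recolor e [set u] (d u).
  apply/ffunP => w; rewrite ffunE inE; case: eqP => [-> // | /eqP wu].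
  by have := eqe (Sub w (in_del wu)); rewrite ffunE.
apply: recolor1_reach => // w uw.
have wu : w != u by apply: contraTneq uw => ->; rewrite adj_irrefl.
have := eqe (Sub w (in_del wu)); rewrite ffunE /= => <-.
by rewrite eq_sym; move/proper_coloringP: pd; apply.
Qed.

(** Keep [u] in the colour of [v]. Neighbours of [u] are neighbours of [v], so whatever colour [v]
    may take, [u] may take with it. *)
Lemma mix_dominated v : u != v -> (forall w, adj u w -> adj v w) -> mix G k.
Proof.
move=> uv dom.
have nuv : ~~ adj u v by apply/negP => /dom; rewrite adj_irrefl.
apply: (mix_delete (Q := fun c => c u = c v)) => [c pc | c z x zu pc cuv h].
  exists (recolor c [set u] (c v)); last by rewrite !ffunE !inE eqxx eq_sym (negPf uv).
  apply: recolor1_reach => // w /dom vw.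
  by rewrite eq_sym; move/proper_coloringP: pc; apply.
have [zv | zv] := eqVneq z v.
  subst z; exists (recolor c [set u; v] x).
    apply: recolor_reach => // y w; rewrite !inE => yuv yw.
    have vw : adj v w by case/orP: yuv yw => /eqP-> // /dom.
    have wu : w != u by apply: contraTneq vw => ->; rewrite adj_sym.
    have wv : w != v by apply: contraTneq vw => ->; rewrite adj_irrefl.
    by rewrite negb_or wu wv h.
  split; first by rewrite !ffunE !inE !eqxx orbT.
  by move=> w wu; rewrite ffunE !inE (negPf wu).
exists (recolor c [set z] x).
  apply: recolor1_reach => // w zw.
  have [wu | wu] := eqVneq w u; last exact: h.
  by rewrite wu cuv; apply: h; rewrite 1?eq_sym // adj_sym dom // -wu adj_sym.
split; last by move=> w _; rewrite ffunE inE.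
by rewrite !ffunE !inE eq_sym (negPf zu) eq_sym (negPf zv).
Qed.

(** Before another vertex receives colour [x], move [u] to a colour that differs from [x] and from
    the colours of all its neighbours. *)
Lemma mix_small_degree : #|[set w | adj u w]|.+1 < k -> mix G k.
Proof.
move=> deg.
have avoid (c : {ffun G -> 'I_k}) (x : 'I_k) :
    exists2 t, t != x & forall w, adj u w -> c w != t.
  have /card_gt0P[t] : 0 < #|~: (x |: [set c w | w in [set w | adj u w]])|.
    rewrite cardsCs setCK card_ord subn_gt0.
    apply: leq_ltn_trans (leq_ltn_trans _ deg).
      rewrite cardsU1; apply: leq_add (leq_b1 _) (leqnn _).
    by rewrite add1n ltnS; apply: leq_imset_card.
  rewrite !inE negb_or => /andP[tx tN]; exists t => // w uw.
  by apply: contraNneq tN => <-; apply: imset_f; rewrite inE.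
apply: (mix_delete (Q := fun=> True)) => [c _ | c z x zu pc _ h].
  by exists c => //; apply: connect0.
have [t tx ht] := avoid c x.
pose c1 := recolor c [set u] t.
have r1 : reach c c1 by apply: recolor1_reach.
exists (recolor c1 [set z] x).
  apply: (reach_trans r1); apply: recolor1_reach; first exact: reach_proper r1 pc.
  by move=> w zw; rewrite ffunE inE; case: ifPn => // wu; apply: h.
by split=> // w wu; rewrite !ffunE !inE (negPf wu).
Qed.

End DeleteVertex.

Section Minimal.
Variable G : sgraph.
Hypothesis minG : minimal_nonmixing G.

Lemma minimal_induced (S : {set G}) : S != setT -> mix (induced S) 4.
Proof.
case: minG => col free _ lt SnT; apply: lt.
- by rewrite card_induced -cardsT proper_card // properEneq SnT subsetT.
- exact: colorable_induced.
- exact: p5free_induced.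
Qed.

Lemma minimal_delete (u : G) : mix (induced [set~ u]) 4.
Proof.
apply: minimal_induced; apply/negP => /eqP/setP/(_ u); by rewrite !inE eqxx.
Qed.

Lemma minimal_incomparable (u v : G) :
  u != v -> exists2 w, adj u w & ~~ adj v w.
Proof.
move=> uv; have [w /andP[uw vw] | h] := pickP [pred w | adj u w & ~~ adj v w].
  by exists w.
case: minG => _ _ nmix _; case: nmix; apply: (mix_dominated (@minimal_delete u) uv) => w uw.
by move: (h w); rewrite /= uw /= => /negbFE.
Qed.

Lemma minimal_degree (u : G) : 2 < #|[set w | adj u w]|.
Proof.
rewrite ltnNge; apply/negP => h; case: minG => _ _ nmix _; case: nmix.
exact: (mix_small_degree (@minimal_delete u)).
Qed.

End Minimal.

(** Recolouring a vertex of [K] becomes recolouring its fibre under [h], which is stable because [h]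
    preserves adjacency. *)
Lemma reach_pullback (G K : sgraph) k (h : G -> K) (c c' : {ffun K -> 'I_k}) :
  (forall x y, adj x y -> adj (h x) (h y)) -> proper_coloring c -> reach c c' ->
  reach [ffun x => c (h x)] [ffun x => c' (h x)].
Proof.
move=> hom pc rcc'; pose pull (e : {ffun K -> 'I_k}) := [ffun x => e (h x)].
have pp e : proper_coloring e -> proper_coloring (pull e).
  move=> /proper_coloringP pe; apply/proper_coloringP => x y xy; rewrite !ffunE; exact/pe/hom.
have [||d rd] := @reach_simulation G K k k
    (fun e d => proper_coloring d /\ d = pull e) _ c c' (pull c) rcc'; last first.
- by case=> _ def_d; rewrite def_d in rd.
- by split=> //; apply: pp.
move=> e v x d pe pe' [pd ->]; exists (pull (recolor e [set v] x)); last first.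
  by split=> //; apply: pp.
have -> : pull (recolor e [set v] x) = recolor (pull e) [set z | h z == v] x.
  by apply/ffunP => z; rewrite !ffunE !inE.
apply: recolor_reach; first exact: pp.
move=> z w; rewrite inE => hz zw.
move/proper_coloringP/(_ _ _ zw): (pp _ pe'); rewrite /pull !ffunE !inE hz.
by case: (h w == v); rewrite ?eqxx //= eq_sym.
Qed.

Lemma ord3_third (x y z w : 'I_3) : x != y -> z != x -> z != y ->
  w != x -> w != y -> z = w.
Proof.
move: x y z w; do 4![case=> [[|[|[|//]]] ?]] => //; do ?[move=> _];
  by move=> *; apply: val_inj.
Qed.

(** * Contracting a stable set *)

Section Contraction.
Variables (G : sgraph) (N : {set G}) (n0 : G).
Hypotheses (n0N : n0 \in N) (stableN : forall x y, x \in N -> y \in N -> ~~ adj x y).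

Definition touched (x : G) : bool := [exists n in N, adj n x].

(** The vertex [n0] is kept as the representative of the contracted set, so that vertices of the
    contraction are still vertices of [G]. *)
Definition contract_adj : rel {x : G | x \in ~: (N :\ n0)} := fun x y =>
  if val x == n0 then touched (val y) else
  if val y == n0 then touched (val x) else adj (val x) (val y).

Lemma touched_stable n : n \in N -> touched n = false.
Proof.
move=> nN; apply/existsP => -[m /andP[mN mn]].
by move: (stableN mN nN); rewrite mn.
Qed.

Lemma contract_adj_sym : symmetric contract_adj.
Proof.
move=> x y; rewrite /contract_adj.
have [e1 | _] := eqVneq (val x) n0; have [e2 | _] := eqVneq (val y) n0;
  by rewrite ?e1 ?e2 // adj_sym.
Qed.

Lemma contract_adj_irrefl : irreflexive contract_adj.
Proof.
move=> x; rewrite /contract_adj; case: eqP => [-> | _]; last exact: adj_irrefl.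
exact: touched_stable.
Qed.

Definition contraction : sgraph := SGraph contract_adj_sym contract_adj_irrefl.

Lemma in_contraction (x : G) : (if x \in N then n0 else x) \in ~: (N :\ n0).
Proof. by case: ifP => xN; rewrite !inE ?eqxx ?xN ?andbF. Qed.

Definition to_contraction (x : G) : contraction :=
  exist _ (if x \in N then n0 else x) (in_contraction x).

Lemma to_contraction_hom x y : adj x y -> adj (to_contraction x) (to_contraction y).
Proof.
move=> xy; rewrite /adj /= /contract_adj /=.
have nN z : z \notin N -> (z == n0) = false.
  by move=> zN; apply: contraNF zN => /eqP->.
have [xN | xN] := boolP (x \in N).
  rewrite eqxx; have yN : y \notin N.
    by apply: contraTN xy => yN; apply: stableN.
  by rewrite (negPf yN); apply/existsP; exists x; rewrite xN.
rewrite nN //; have [yN | yN] := boolP (y \in N).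
  by rewrite eqxx; apply/existsP; exists y; rewrite yN adj_sym.
by rewrite nN.
Qed.

Lemma card_contraction n1 : n1 \in N -> n1 != n0 -> #|contraction| < #|G|.
Proof.
move=> n1N n10; rewrite card_sig; apply: proper_card.
by apply/properP; split; [exact/subsetP | exists n1; rewrite ?inE ?n10 ?n1N].
Qed.

Lemma proper_contraction k (c : {ffun G -> 'I_k}) :
  proper_coloring c -> (forall x, x \in N -> c x = c n0) ->
  proper_coloring [ffun x : contraction => c (val x)].
Proof.
move=> /proper_coloringP pc cN; apply/proper_coloringP => x y; rewrite !ffunE /adj /= /contract_adj.
case: eqP => [-> | _]; last case: eqP => [-> | _]; last exact: pc.
  by case/existsP => n /andP[nN] /pc; rewrite cN.
by case/existsP => n /andP[nN] /pc; rewrite cN // eq_sym.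
Qed.

(** On an induced P5 through [n0], replace [n0] by a vertex of [N] adjacent to its neighbours on the
    path; if there are two, they are nonadjacent and [link] provides one. The other path vertices
    are untouched, so the path stays induced. *)
Lemma p5free_contraction : p5free G ->
  (forall p q, touched p -> touched q -> ~~ adj p q ->
    exists2 n, n \in N & adj n p && adj n q) ->
  p5free contraction.
Proof.
move=> free link.
have lift p q : touched p -> touched q -> ~~ adj p q ->
    exists n, [/\ n \in N, adj n p, adj n q, adj p n & adj q n].
  move=> tp tq pq; have [n nN /andP[np nq]] := link p q tp tq pq.
  by exists n; split=> //; rewrite adj_sym.
have off n p : n \in N -> ~~ touched p -> ~~ adj n p /\ ~~ adj p n.
  move=> nN tp; rewrite [adj p n]adj_sym; suff h : ~~ adj n p by split.
  by apply: contra tp => np; apply/existsP; exists n; rewrite nN.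
have one p : touched p -> exists n, [/\ n \in N, adj n p & adj p n].
  by case/existsP=> n /andP[nN np]; exists n; split=> //; rewrite adj_sym.
move=> [a ha] [b hb] [c hc] [d hd] [e he]; rewrite /adj /= /contract_adj /=.
move: {ha hb hc hd he} (touched_stable n0N).
(* If [n0] occurred at two positions, the adjacencies would contradict each other. Six cases
   survive: one for each position, and one where [n0] is not on the path. *)
have [ea | _] := eqVneq a n0; have [eb | _] := eqVneq b n0;
have [ec | _] := eqVneq c n0; have [ed | _] := eqVneq d n0;
have [ee | _] := eqVneq e n0 => t0;
  rewrite ?(ea, eb, ec, ed, ee) ?t0 // => ab bc cd de ac ad ae bd be ce;
  try by match goal with H : is_true ?p, K : is_true (~~ ?p) |- _ =>
    rewrite H in K end.
- have [n [nN nb bn]] := one b ab.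
  case: (off n c nN ac) => nc _; case: (off n d nN ad) => nd _.
  case: (off n e nN ae) => ne _; exact: (free n b c d e).
- have [n [nN na nc an cn]] := lift a c ab bc ac.
  case: (off n d nN bd) => nd _; case: (off n e nN be) => ne _.
  exact: (free a n c d e).
- have [n [nN nb nd bn dn]] := lift b d bc cd bd.
  case: (off n a nN ac) => _ na; case: (off n e nN ce) => ne _.
  exact: (free a b n d e).
- have [n [nN nc ne cn en]] := lift c e cd de ce.
  case: (off n a nN ad) => _ na; case: (off n b nN bd) => _ nb.
  exact: (free a b c n e).
- have [n [nN nd dn]] := one d de.
  case: (off n a nN ae) => _ na; case: (off n b nN be) => _ nb.
  case: (off n c nN ce) => _ nc; exact: (free a b c d n).
- exact: (free a b c d e).
Qed.

End Contraction.

(** The contraction is smaller, is coloured by [f], and is P5-free by [link], hence it is 4-mixing.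
    Colourings constant on [N] are pullbacks from it, so if every 4-colouring reached one of these,
    [G] would be 4-mixing too. *)
Lemma minimal_contraction (G : sgraph) (N : {set G}) (f : {ffun G -> 'I_3}) n0 n1 :
  minimal_nonmixing G -> n0 \in N -> n1 \in N -> n1 != n0 -> proper_coloring f ->
  (forall x y, x \in N -> y \in N -> f x = f y) ->
  (forall p q, touched N p -> touched N q -> ~~ adj p q ->
    exists2 n, n \in N & adj n p && adj n q) ->
  ~ (forall c : {ffun G -> 'I_4}, proper_coloring c ->
      exists2 d, reach c d & forall x y, x \in N -> y \in N -> d x = d y).
Proof.
move=> [_ free nmix lt] n0N n1N n10 pf fN link merge; apply: nmix.
have stableN x y : x \in N -> y \in N -> ~~ adj x y.
  move=> xN yN; apply: contraTN isT => /(proper_coloringP _ pf).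
  by rewrite (fN x y) ?eqxx.
have mixK : mix (contraction n0N stableN) 4.
  apply: lt; first exact: card_contraction n1N n10.
    apply/colorableP; exists [ffun x : contraction n0N stableN => f (val x)].
    by apply: proper_contraction => // x xN; apply: fN.
  exact: p5free_contraction.
move=> c d pc pd; have [c1 rc c1N] := merge c pc; have [d1 rd d1N] := merge d pd.
apply: (reach_trans rc); rewrite reach_sym; apply: (reach_trans rd).
rewrite reach_sym.
have pull (e : {ffun G -> 'I_4}) : (forall x y, x \in N -> y \in N -> e x = e y) ->
    e = [ffun x => [ffun y : contraction n0N stableN => e (val y)]
                     (to_contraction n0N stableN x)].
  move=> eN; apply/ffunP => x; rewrite !ffunE /=; case: ifP => // xN; exact: eN.
rewrite (pull _ c1N) (pull _ d1N); apply: reach_pullback.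
- exact: to_contraction_hom.
- apply: proper_contraction; [exact: reach_proper rc pc | by move=> x xN; apply: c1N].
- apply: mixK; apply: proper_contraction.
  + exact: reach_proper rc pc.
  + by move=> x xN; apply: c1N.
  + exact: reach_proper rd pd.
  + by move=> x xN; apply: d1N.
Qed.

Lemma ord4_cover (x y z t w : 'I_4) : uniq [:: x; y; z; t] -> w \in [:: x; y; z; t].
Proof.
move=> u; have sub : {subset [:: x; y; z; t] <= enum 'I_4}.
  by move=> i _; rewrite mem_enum.
have sz : size (enum 'I_4) <= size [:: x; y; z; t] by rewrite size_enum_ord.
by have [_ ->] := uniq_min_size u sub sz; rewrite mem_enum.
Qed.

Lemma adj_neq (G : sgraph) (x y : G) : adj x y -> x != y.
Proof. by apply: contraTneq => ->; rewrite adj_irrefl. Qed.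

(** * Adjacent twins *)

Section Twins.
Variables (G : sgraph) (f : {ffun G -> 'I_3}) (a b : G).
Hypotheses (minG : minimal_nonmixing G) (pf : proper_coloring f).
Hypotheses (ab : adj a b)
  (twin : forall w, w != a -> w != b -> adj a w = adj b w).

(** By [twin] this is the common neighbourhood of [a] and [b]. *)
Let N := [set w | adj a w & w != b].

Let free : p5free G. Proof. by case: minG. Qed.

Let fneq x y : adj x y -> f x != f y. Proof. exact/proper_coloringP. Qed.

Lemma twin_nbr n : n \in N -> [/\ adj a n, adj b n, n != a & n != b].
Proof.
rewrite inE => /andP[an nb]; have na : n != a by rewrite eq_sym adj_neq.
by split=> //; rewrite -twin.
Qed.

Lemma twin_nonnbr p : p \notin N -> p != a -> p != b -> ~~ adj a p /\ ~~ adj b p.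
Proof.
rewrite inE => pN pa pb; rewrite -twin //.
by suff h : ~~ adj a p by []; apply: contra pN => ->.
Qed.

Lemma twin_nbr_color x y : x \in N -> y \in N -> f x = f y.
Proof.
case/twin_nbr=> ax bx _ _ /twin_nbr[ay by_ _ _].
apply: (@ord3_third (f a) (f b)); first exact: fneq.
- by rewrite eq_sym fneq.
- by rewrite eq_sym fneq.
- by rewrite eq_sym fneq.
- by rewrite eq_sym fneq.
Qed.

Lemma twin_nbr_stable x y : x \in N -> y \in N -> ~~ adj x y.
Proof.
by move=> xN yN; apply: contraTN isT => /fneq; rewrite (twin_nbr_color xN yN) eqxx.
Qed.

(** If neither of the vertices [n], [m] of [N] that touch [p] and [q] is adjacent to both, then p,
    n, a, m, q is an induced P5. The twins themselves are adjacent to all of [N]. *)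
Lemma twin_link p q : touched N p -> touched N q -> ~~ adj p q ->
  exists2 n, n \in N & adj n p && adj n q.
Proof.
case/existsP=> n /andP[nN np] /existsP[m /andP[mN mq]] pq.
have [an bn na nb] := twin_nbr nN; have [am bm ma mb] := twin_nbr mN.
have [pa | pa] := eqVneq p a; first by exists m; rewrite // mq pa adj_sym am.
have [pb | pb] := eqVneq p b; first by exists m; rewrite // mq pb adj_sym bm.
have [qa | qa] := eqVneq q a; first by exists n; rewrite // np qa adj_sym an.
have [qb | qb] := eqVneq q b; first by exists n; rewrite // np qb adj_sym bn.
have notin x z : x \in N -> adj x z -> z \notin N.
  by move=> xN; apply: contraTN => zN; apply: twin_nbr_stable.
have [ap _] := twin_nonnbr (notin n p nN np) pa pb.
have [aq _] := twin_nonnbr (notin m q mN mq) qa qb.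
have [nq | nq] := boolP (adj n q); first by exists n; rewrite // np.
have [mp | mp] := boolP (adj m p); first by exists m; rewrite // mp.
case: (@free p n a m q); rewrite ?(adj_sym p) ?(adj_sym n a) //.
- by rewrite adj_sym.
- exact: twin_nbr_stable.
Qed.

(* A monochromatic N leaves the two twins free; the only way a recolouring
   of G - {a, b} fails to lift is this configuration. *)
Lemma twin_stuck (d : {ffun G -> 'I_4}) (A B C : 'I_4) n p :
  proper_coloring d -> C != A -> C != B ->
  (forall w, w \in N -> d w = A \/ d w = B) ->
  n \in N -> d n = A -> adj n p -> p != a -> p != b -> d p = B ->
  (forall w, adj n w -> w != a -> w != b -> d w != C) ->
  exists2 d', reach d d' & forall x y, x \in N -> y \in N -> d' x = d' y.
Proof.
move=> pd CA CB dN nN dn np pa pb dp nC.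
have dneq x y : adj x y -> d x != d y by apply/proper_coloringP.
have AB : A != B by rewrite -dn -dp dneq.
have same x y : d x = d y -> ~~ adj x y.
  by move=> e; apply: contraTN isT => /dneq; rewrite e eqxx.
have [an bn na nb] := twin_nbr nN.
have notin x z : x \in N -> adj x z -> z \notin N.
  by move=> xN; apply: contraTN => zN; apply: twin_nbr_stable.
have [ap _] := twin_nonnbr (notin _ _ nN np) pa pb.
(* These are the vertices that prevent [N] from becoming entirely [A]; the plan is to move them all
   to [C] first. *)
pose M := [set r | d r == A & touched N r].
have inM r : r \in M ->
    [/\ d r = A, ~~ adj r a, ~~ adj r b & exists m, [/\ m \in N, adj m r & d m = B]].
  rewrite inE => /andP[/eqP dr /existsP[m /andP[mN mr]]].
  have dm : d m = B.
    by case: (dN m mN) => // dm; move: (same m r); rewrite dm dr mr => /(_ erefl).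
  have ra : r != a by apply/eqP => e; move: (dneq _ _ an); rewrite dn -e dr eqxx.
  have rb : r != b by apply/eqP => e; move: (dneq _ _ bn); rewrite dn -e dr eqxx.
  have [ar br] := twin_nonnbr (notin _ _ mN mr) ra rb.
  by split; rewrite // 1?adj_sym //; exists m.
(* The plan is carried out first; that no vertex of [M] sees colour [C] is proved afterwards, by
   contradiction. *)
have noC r x : r \in M -> adj r x -> d x != C; last first.
  have rM : reach d (recolor d M C).
    apply: recolor_reach => // r w rM rw; rewrite (noC r) // andbT.
    have [dr _ _ _] := inM r rM.
    by rewrite inE negb_and -dr eq_sym dneq.
  exists (recolor (recolor d M C) N A); last first.
    by move=> x y xN yN; rewrite !ffunE xN yN.
  apply: (reach_trans rM); apply: recolor_reach; first exact: reach_proper rM pd.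
  move=> m w mN mw; rewrite (notin m) // ffunE; case: ifPn => // wM.
  rewrite inE negb_and in wM; case/orP: wM => // /negP[].
  by apply/existsP; exists m; rewrite mN.
move=> rM rx; apply/negP => /eqP dx.
have [dr ra rb [m [mN mr dm]]] := inM r rM.
have [am bm ma mb] := twin_nbr mN.
have mn : ~~ adj m n by apply: twin_nbr_stable.
have mp : ~~ adj m p by apply: same; rewrite dm dp.
have nr : ~~ adj n r by apply: same; rewrite dn dr.
(* Otherwise r, m, a, n, p is an induced P5. Similarly x, r, p, n, a below forces x to be adjacent
   to p, so x, p, r form a triangle. *)
have rp : adj r p.
  apply/negPn/negP => rp; apply: (@free r m a n p) => //; rewrite 1?adj_sym //.
have xa : x != a by apply: contraNneq ra => <-.
have xb : x != b by apply: contraNneq rb => <-.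
have xN : x \notin N.
  by apply/negP => /dN[] e; move: CA CB; rewrite -dx e eqxx.
have [ax bx] := twin_nonnbr xN xa xb.
have nx : ~~ adj n x by apply: contraTN isT => /nC/(_ xa xb); rewrite dx eqxx.
have xp : adj x p.
  apply/negPn/negP => xp; apply: (@free x r p n a) => //; rewrite 1?adj_sym //.
have fmn := twin_nbr_color mN nN.
have fx : f x = f n.
  apply: (@ord3_third (f p) (f r)).
  - by rewrite fneq // adj_sym.
  - by rewrite fneq.
  - by rewrite fneq // adj_sym.
  - by rewrite fneq.
  - by rewrite -fmn fneq.
have samef y z : f y = f z -> ~~ adj y z.
  by move=> e; apply: contraTN isT => /fneq; rewrite e eqxx.
have mx : ~~ adj m x by apply: samef; rewrite fmn.
(* Minimum degree 3 gives [x] a neighbour outside the triangle. It will have to be adjacent to both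
   [p] and [r], hence have the same [f]-colour as its neighbour [x]. *)
have [u xu /andP[up ur]] : exists2 u, adj x u & (u != p) && (u != r).
  have := minimal_degree minG x; rewrite ltnNge => /negP deg.
  have /subsetPn[u] : ~~ ([set w | adj x w] \subset [set p; r]).
    apply/negP => /subset_leq_card h; apply: deg; apply: leq_trans h _.
    by rewrite cards2; case: (p != r).
  by rewrite !inE negb_or => xu h; exists u.
have ub : u != b by apply: contraTneq xu => ->; rewrite adj_sym.
have ua : u != a by apply: contraTneq xu => ->; rewrite adj_sym.
have uN : u \notin N.
  apply/negP => uN; move: (samef x u).
  by rewrite xu fx (twin_nbr_color uN nN) => /(_ erefl).
have [au _] := twin_nonnbr uN ua ub.
(* If [u] misses p', the path u, x, p', n', a forces u to be adjacent to n', then x, u, n', a, m'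
   forces u to be adjacent to m', and finally p', x, u, m', a is an induced P5. *)
have key p' n' m' : n' \in N -> m' \in N -> adj x p' -> adj p' n' ->
    ~~ adj u p' -> ~~ adj x n' -> ~~ adj x m' -> ~~ adj p' a -> ~~ adj p' m' ->
    False.
  move=> n'N m'N xp' pn' up' xn' xm' pa' pm'.
  have [an' _ _ _] := twin_nbr n'N; have [am' _ _ _] := twin_nbr m'N.
  have nm' : ~~ adj n' m' by apply: twin_nbr_stable.
  have un' : adj u n'.
    apply/negPn/negP => un'.
    by apply: (@free u x p' n' a) => //; rewrite 1?adj_sym.
  have um' : adj u m'.
    apply/negPn/negP => um'.
    by apply: (@free x u n' a m') => //; rewrite 1?adj_sym.
  by apply: (@free p' x u m' a) => //; rewrite 1?adj_sym.
have [up' | up'] := boolP (adj u p); last first.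
  by apply: (key p n m) => //; rewrite 1?adj_sym.
have [ur' | ur'] := boolP (adj u r); last first.
  by apply: (key r m n) => //; rewrite 1?adj_sym // adj_sym.
have : f u = f x.
  apply: (@ord3_third (f p) (f r)); rewrite ?fneq //; by rewrite adj_sym.
by apply/eqP; rewrite eq_sym fneq.
Qed.

(** Recolour [G] minus the twins towards a 3-colouring in which [N] is monochromatic, and lift this
    to [G] with both twins frozen. Vertices of [N] then always use one of the two colours missing on
    the twins, and they need not follow the smaller graph. *)
Lemma twin_merge (c : {ffun G -> 'I_4}) : proper_coloring c ->
  exists2 d, reach c d & forall x y, x \in N -> y \in N -> d x = d y.
Proof.
move=> pc; have cneq x y : adj x y -> c x != c y by apply/proper_coloringP.
have [/forall_inP cN | /forall_inPn[n1 n1N /forall_inPn[m1 m1N nm]]] :=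
    boolP [forall (x | x \in N), [forall (y | y \in N), c x == c y]].
  exists c; first exact: connect0.
  by move=> x y xN yN; move/forall_inP/(_ y yN)/eqP: (cN x xN).
have [an1 bn1 n1a n1b] := twin_nbr n1N; have [am1 bm1 _ _] := twin_nbr m1N.
set A := c n1 in nm; set B := c m1 in nm.
have cover x : x \in [:: A; B; c a; c b].
  by apply: ord4_cover; rewrite /= !inE !negb_or nm /A /B !cneq // adj_sym.
pose S := ~: [set a; b]; pose H := induced S.
have inS w : w != a -> w != b -> w \in S by rewrite !inE negb_or => -> ->.
have outS (w : H) : val w != a /\ val w != b.
  by have := valP w; rewrite !inE negb_or => /andP.
have mixH : mix H 4.
  by apply: minimal_induced => //; apply/eqP/setP => /(_ a); rewrite !inE eqxx.
(* The target is [f] with its colours renamed so that the twins keep their colours or exchange roles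
   with no effect on [N], which lies in the class of [A]. *)
pose t : {ffun G -> 'I_4} :=
  [ffun w => if f w == f n1 then A else if f w == f a then c a else c b].
have pt : proper_coloring t.
  apply/proper_coloringP => x y /fneq; rewrite !ffunE => fxy.
  have [e1 | n1x] := eqVneq (f x) (f n1).
    rewrite -e1 (eq_sym (f y)) (negPf fxy); case: ifP => _.
      by rewrite eq_sym cneq.
    by rewrite eq_sym cneq.
  have [e2 | n1y] := eqVneq (f y) (f n1).
    by case: ifP => _; rewrite cneq.
  have [e3 | ax] := eqVneq (f x) (f a).
    by rewrite -e3 (eq_sym (f y)) (negPf fxy) cneq.
  have [e4 | ay] := eqVneq (f y) (f a); first by rewrite eq_sym cneq.
  case/eqP: fxy; apply: (@ord3_third (f n1) (f a)) => //.
  by rewrite eq_sym fneq.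
pose merged (d : {ffun G -> 'I_4}) :=
  exists2 d', reach d d' & forall x y, x \in N -> y \in N -> d' x = d' y.
(* Either the goal has already been reached along the way, or [d] follows [g] outside [N]. *)
pose R (g : {ffun H -> 'I_4}) (d : {ffun G -> 'I_4}) := merged d \/
  [/\ proper_coloring d, d a = c a, d b = c b &
      forall x : H, val x \notin N -> g x = d (val x)].
have [||d rd Rd] := @reach_simulation G H 4 4 R _ _ _ c
    (mixH _ _ (proper_restrict S pc) (proper_restrict S pt)); last first.
- have [[d' rd' dN] | [pd da db dt]] := Rd.
    by exists d' => //; apply: reach_trans rd rd'.
  exists (recolor d N A); last by move=> x y xN yN; rewrite !ffunE xN yN.
  apply: (reach_trans rd); apply: recolor_reach => // n w nN nw.
  have wN : w \notin N by apply: contraTN nw => wN; apply: twin_nbr_stable.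
  rewrite wN /=; have [wa | wa] := eqVneq w a; first by rewrite wa da cneq.
  have [wb | wb] := eqVneq w b; first by rewrite wb db cneq.
  have := dt (Sub w (inS w wa wb)) wN; rewrite !ffunE /= => <-.
  rewrite (twin_nbr_color n1N nN) (eq_sym (f w)) (negPf (fneq nw)).
  by case: ifP => _; rewrite cneq.
- by right; split=> // x _; rewrite ffunE.
move=> g v x d pg pg' [md | [pd da db dg]]; first by exists d; [apply: connect0 | left].
have dneq y z : adj y z -> d y != d z by apply/proper_coloringP.
have [va vb] := outS v.
have [vN | vN] := boolP (val v \in N).
  exists d; [exact: connect0 | right; split=> // y yN].
  rewrite ffunE inE dg //; case: eqP => // e; by rewrite e vN in yN.
have [av bv] := twin_nonnbr vN va vb.
have vx w : w \notin N -> adj (val v) w -> d w != x.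
  move=> wN vw; have wa : w != a by apply: contraNneq av => <-; rewrite adj_sym.
  have wb : w != b by apply: contraNneq bv => <-; rewrite adj_sym.
  move/proper_coloringP/(_ v (Sub w (inS w wa wb)) vw): pg'.
  rewrite !ffunE !inE eqxx; case: ifP => [/eqP e | _]; last by rewrite dg // eq_sym.
  by move: vw; rewrite -e adj_irrefl.
have finish d1 : reach d d1 -> d1 a = c a -> d1 b = c b ->
    (forall w, w \notin N -> d1 w = d w) ->
    (forall w, w \in N -> adj (val v) w -> d1 w != x) ->
    exists2 d', reach d d' & R (recolor g [set v] x) d'.
  move=> r1 a1 b1 eq1 h1; have pd1 := reach_proper r1 pd.
  have r2 : reach d1 (recolor d1 [set val v] x).
    apply: recolor1_reach => // w vw; have [wN | wN] := boolP (w \in N).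
      exact: h1.
    by rewrite eq1 // vx.
  exists (recolor d1 [set val v] x); first exact: reach_trans r1 r2.
  right; split; first exact: reach_proper r2 pd1.
  - by rewrite ffunE inE eq_sym (negPf va).
  - by rewrite ffunE inE eq_sym (negPf vb).
  - by move=> y yN; rewrite !ffunE !inE (inj_eq val_inj) dg // eq1.
(* Only these vertices can block giving colour [x] to [v]. They are moved to [y], the other colour
   available on [N], unless one of them has a neighbour of colour [y]. *)
pose F := [set n in N | adj (val v) n & d n == x].
have [F0 | [n nF]] := set_0Vmem F.
  apply: (finish d) => // [|w wN vw]; first exact: connect0.
  apply/eqP => dw; have : w \in F by rewrite !inE in wN *; rewrite wN vw dw eqxx.
  by rewrite F0 inE.
have inF w : w \in F -> [/\ w \in N, adj (val v) w & d w = x].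
  by rewrite inE => /and3P[wN vw /eqP].
have dAB w : w \in N -> d w = A \/ d w = B.
  case/twin_nbr=> aw bw _ _; have := cover (d w).
  rewrite !inE -da -db (eq_sym (d w) (d a)) (eq_sym (d w) (d b)).
  rewrite (negPf (dneq _ _ aw)) (negPf (dneq _ _ bw)) !orbF.
  by case/orP=> /eqP->; [left | right].
pose y := if x == A then B else A.
have xAB : x = A \/ x = B by have [nN _ <-] := inF n nF; apply: dAB.
have xy : y != x.
  by rewrite /y; case: ifP => [/eqP-> | /negbT xA]; rewrite eq_sym.
have dxy w : w \in N -> d w = x \/ d w = y.
  move/dAB; rewrite /y; case: xAB => ->; first by rewrite eqxx.
  by rewrite eq_sym (negPf nm) => -[]; [right | left].
have yA : y = A \/ y = B by rewrite /y; case: ifP; [right | left].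
have ynab w : w = a \/ w = b -> d w != y.
  by case=> ->; rewrite ?da ?db; case: yA => ->; rewrite cneq.
have [noy | ] := boolP [forall (m | m \in F), forall z, adj m z ==> (d z != y)].
  have r1 : reach d (recolor d F y).
    apply: recolor_reach => // m z mF mz.
    have [mN _ _] := inF m mF.
    have zN : z \notin N by apply: contraTN mz => zN; apply: twin_nbr_stable.
    move/forall_inP/(_ m mF)/forallP/(_ z): noy; rewrite mz /= => ->.
    by rewrite inE (negPf zN).
  apply: (finish _ r1).
  - rewrite ffunE; case: ifP => // /inF[aN _ _].
    by case: (twin_nbr aN); rewrite eqxx.
  - rewrite ffunE; case: ifP => // /inF[bN _ _].
    by case: (twin_nbr bN); rewrite eqxx.
  - by move=> w wN; rewrite ffunE; case: ifP => // /inF[wN' _ _]; rewrite wN' in wN.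
  - move=> w wN vw; rewrite ffunE; case: ifPn => // wF.
    by apply: contraNneq wF => dw; rewrite inE wN vw dw eqxx.
case/forall_inPn=> {nF}n nF /forallPn[z]; rewrite negb_imply negbK => /andP[nz /eqP dz].
have [nN vn dn] := inF n nF.
have [an bn na nb] := twin_nbr nN.
have za : z != a by apply/eqP => e; move: (ynab a (or_introl erefl)); rewrite -e dz eqxx.
have zb : z != b by apply/eqP => e; move: (ynab b (or_intror erefl)); rewrite -e dz eqxx.
have zN : z \notin N by apply: contraTN nz => zN; apply: twin_nbr_stable.
pose n' : H := Sub n (inS n na nb); pose z' : H := Sub z (inS z za zb).
exists d; [exact: connect0 | left].
(* The third colour is the one that [n] has in the smaller graph: it differs from [x] because [v]
   may become [x] there, and from the colours of all neighbours of [n] other than the twins. *)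
apply: (@twin_stuck d x y (g n') n z) => //.
- move/proper_coloringP/(_ v n' vn): pg'; rewrite !ffunE !inE eqxx eq_sym.
  by case: ifP => // /eqP e; move: vN; rewrite -e nN.
- move/proper_coloringP/(_ n' z' nz): pg.
  by rewrite (dg z') // dz.
- move=> w nw wa wb; have wN : w \notin N.
    by apply: contraTN nw => wN; apply: twin_nbr_stable.
  move/proper_coloringP/(_ n' (Sub w (inS w wa wb)) nw): pg.
  by rewrite [X in _ != X]dg // eq_sym.
Qed.

Lemma minimal_no_twins : False.
Proof.
(* Contracting [N] makes the graph smaller only if [N] has two vertices; this follows from the
   degree of [a] being at least 3. *)
have [n0 n0N [n1 n1N n10]] : exists2 n0, n0 \in N & exists2 n1, n1 \in N & n1 != n0.
  have : 1 < #|N|.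
    have := minimal_degree minG a; rewrite (cardsD1 b) inE ab ltnS.
    suff -> : [set w | adj a w] :\ b = N by [].
    by apply/setP => w; rewrite !inE andbC.
  by case/card_gt1P=> n1 [n0 [n1N n0N n10]]; exists n0 => //; exists n1.
exact: (minimal_contraction minG n0N n1N n10 pf twin_nbr_color twin_link twin_merge).
Qed.

End Twins.

(** * Excluded induced subgraphs of a minimal counterexample *)

(* A graph on 0, ..., n - 1 is coded by the strict upper half of its adjacency
   matrix: row i lists the adjacencies of i to i + 1, ..., n - 1. *)
Notation halfmatrix := (seq (seq bool)).

Definition entry (M : halfmatrix) (i j : nat) : bool :=
  if i < j then nth false (nth [::] M i) (j - i.+1)
  else if j < i then nth false (nth [::] M j) (i - j.+1) else false.

(** Decodes the compact form used in the certificate, where each vertex lists its later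
    neighbours. *)
Definition halfmatrix_of (s : seq (seq nat)) : halfmatrix :=
  [seq [seq j \in nth [::] s i | j <- iota i.+1 (size s - i.+1)] | i <- iota 0 (size s)].

Fixpoint submatrix (M : halfmatrix) (s : seq nat) : halfmatrix :=
  if s is i :: s' then [seq entry M i j | j <- s'] :: submatrix M s' else [::].

Fixpoint colorings (k : nat) (M : halfmatrix) : seq (seq nat) :=
  if M is r :: M' then
    flatten [seq [seq x :: c | x <- iota 0 k & all2 (fun e y => e ==> (y != x)) r c]
            | c <- colorings k M']
  else [:: [::]].

Fixpoint bitseqs (n : nat) : seq (seq bool) :=
  if n is n'.+1 then
    [seq false :: e | e <- bitseqs n'] ++ [seq true :: e | e <- bitseqs n']
  else [:: [::]].

(* A pair (P, Q) of lists of vertices: a new vertex complete to P and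
   anticomplete to Q would create an induced path on five vertices. *)
Definition p5_patterns (M : halfmatrix) : seq (seq nat * seq nat) :=
  let I := iota 0 (size M) in
  let A := entry M in
  let E := flatten [seq [seq (i, j) | j <- I & A i j] | i <- I] in
  flatten [seq flatten [seq let: (a, b) := p in let: (c, d) := q in
      if b == c then
        if (a == d) || A a d then [::] else
        [seq ([:: x; a], [:: b; d]) | x <- I & ~~ [|| A x a, A x b | A x d]]
      else if A a c || A a d || A b d then [::]
      else if A b c then [:: ([:: a], [:: b; c; d])]
      else [:: ([:: a; c], [:: b; d])]
    | q <- E] | p <- E].

Definition matches (e : seq bool) (p : seq nat * seq nat) : bool :=
  all (nth false e) p.1 && all (fun i => ~~ nth false e i) p.2.

(** Reasons why a minimal counterexample needs a vertex outside a given induced subgraph: no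
    comparable neighbourhoods, minimum degree 3, no adjacent twins. [Component] lists pairs that
    could be merged if the subgraph had no outside neighbour. *)
Inductive rule :=
  | Dominated of nat & nat
  | LowDegree of nat
  | Twins of nat & nat
  | Component of seq (nat * nat).

Definition demands (r : rule) (e : seq bool) : bool :=
  match r with
  | Dominated u v => nth false e u && ~~ nth false e v
  | LowDegree u => nth false e u
  | Twins u v => nth false e u != nth false e v
  | Component _ => has id e
  end.

(** The possible adjacency rows of the vertex demanded by [r], filtered by necessary conditions: no
    induced P5 through it, and 3-colourability of the extended graph. *)
Definition extensions (M : halfmatrix) (r : rule) : seq (seq bool) :=
  let P := p5_patterns M in
  let C := colorings 3 M in
  [seq e <- bitseqs (size M) | [&& demands r e, ~~ has (matches e) P
    & has (fun c => has (fun x => all2 (fun b y => b ==> (y != x)) e c) (iota 0 3)) C]].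

Definition neighbors (M : halfmatrix) (i : nat) : seq nat :=
  [seq j <- iota 0 (size M) | entry M i j].

(** A finite test of what [minimal_contraction] asks of the pair [i], [j]: the linking condition,
    and that every 4-colouring gives them a common colour after at most one preparatory and one
    merging recolouring. *)
Definition mergeable (M : halfmatrix) (i j : nat) : bool :=
  let nb := [seq neighbors M v | v <- iota 0 (size M)] in
  let allowed c v x := all (fun w => nth 0 c w != x) (nth [::] nb v) in
  let mergeable1 c := [|| nth 0 c i == nth 0 c j,
    allowed c i (nth 0 c j) | allowed c j (nth 0 c i)] in
  [&& i < size M, j < size M, i != j,
    all (fun p => (p \in nth [::] nb j) ||
      all (fun q => (q \in nth [::] nb i) || entry M p q) (nth [::] nb j))
      (nth [::] nb i)
    & all (fun c => mergeable1 c ||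
        has (fun v => has (fun x => allowed c v x && mergeable1 (set_nth 0 c v x))
          (iota 0 4)) (iota 0 (size M)))
      (colorings 4 M)].

(** For [Component], every 3-colouring must give equal colours to some mergeable pair, so that
    contracting that pair preserves 3-colourability. *)
Definition applicable (r : rule) (M : halfmatrix) : bool :=
  let I := iota 0 (size M) in
  match r with
  | Dominated u v => [&& u < size M, v < size M, u != v
      & all (fun w => entry M u w ==> entry M v w) I]
  | LowDegree u => (u < size M) && (count (entry M u) I <= 2)
  | Twins u v => [&& u < size M, v < size M, entry M u v
      & all (fun w => [|| w == u, w == v | entry M u w == entry M v w]) I]
  | Component s => let s' := [seq p <- s | mergeable M p.1 p.2] in
      all (fun c => has (fun p => nth 0 c p.1 == nth 0 c p.2) s') (colorings 3 M)
  end.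

(* The k-th extension of a listed graph contains an earlier listed graph,
   embedded by the k-th entry of the list of embeddings. *)
Fixpoint certified (D : seq halfmatrix)
    (L : seq (seq (seq nat) * rule * seq (nat * seq nat))) : bool :=
  if L is (s, r, K) :: L' then
    let M := halfmatrix_of s in
    let X := extensions M r in
    [&& applicable r M, size K == size X,
      all (fun p => let: (e, (k, t)) := p in
        [&& k < size D, uniq t, all (ltn^~ (size M).+1) t
          & submatrix (e :: M) t == nth [::] D k]) (zip X K)
      & certified (rcons D M) L']
  else true.

(* Found by a computer search for graphs that cannot be induced subgraphs of a
   minimal counterexample: the last one is the single vertex, and the two
   [Component]s are the nine-vertex graph and the prism. *)
Definition certificate : seq (seq (seq nat) * rule * seq (nat * seq nat)) := [::
  ([:: [:: 7; 8; 9; 10; 11]; [:: 6; 8; 9; 10; 11]; [:: 5; 7; 9; 10; 11]; [::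
    4; 6; 8; 10; 11]; [:: 5; 7; 9; 11]; [:: 6; 8; 10]; [:: 7; 9; 11]; [:: 8;
    10]; [:: 9]; [::]; [::]; [::]], Dominated 5 7, [::]);
  ([:: [:: 3]; [:: 5; 6]; [:: 4; 6]; [:: 6]; [:: 5; 6]; [:: 6]; [::]],
    Dominated 1 4, [::]);
  ([:: [:: 4; 6]; [:: 3; 5; 6]; [:: 3; 5; 6]; [:: 5]; [:: 5; 6]; [::]; [::]],
    Dominated 2 1, [::]);
  ([:: [:: 3; 5]; [:: 2; 4]; [:: 4; 5]; [:: 4; 5]; [:: 5]; [::]], Dominated 0
    4, [::]);
  ([:: [:: 3; 4]; [:: 2; 4; 5]; [:: 3; 5]; [:: 5]; [:: 5]; [::]], Dominated 0
    5, [::]);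
  ([:: [:: 4; 5]; [:: 2; 3]; [:: 3; 5]; [:: 4]; [:: 5]; [::]], LowDegree 0,
    [:: (2, [:: 2; 0; 5; 1; 3; 6; 4]); (2, [:: 2; 0; 6; 1; 4; 5; 3])]);
  ([:: [:: 3]; [:: 4; 5]; [:: 4; 5]; [:: 5]; [:: 5]; [::]], Dominated 2 1, [::
    (1, [:: 1; 0; 2; 4; 5; 3; 6])]);
  ([:: [:: 7; 8; 9; 10]; [:: 6; 8; 9; 10]; [:: 5; 7; 9; 10]; [:: 4; 6; 8; 9;
    10]; [:: 5; 7; 9; 10]; [:: 6; 8; 10]; [:: 7; 9]; [:: 8]; [::]; [::];
    [::]], Dominated 2 4, [:: (0, [:: 3; 5; 1; 7; 2; 9; 4; 0; 6; 11; 8; 10])]);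
  ([:: [:: 7; 8; 9; 10]; [:: 6; 8; 9; 10]; [:: 5; 7; 8; 9; 10]; [:: 4; 6; 8;
    9; 10]; [:: 5; 7; 9; 10]; [:: 6; 8; 10]; [:: 7; 9]; [:: 8]; [::]; [::];
    [::]], Dominated 1 3, [:: (0, [:: 4; 6; 2; 8; 1; 0; 3; 10; 5; 11; 7; 9])]);
  ([:: [:: 5; 7; 8; 9]; [:: 4; 6; 8; 9]; [:: 5; 6; 7; 8; 9]; [:: 4; 6; 7; 8;
    9]; [:: 5; 7; 9]; [:: 6; 8]; [:: 7]; [::]; [::]; [::]], Dominated 0 2, [::
    (8, [:: 0; 2; 6; 4; 8; 3; 10; 1; 9; 5; 7])]);
  ([:: [:: 6; 7; 8; 9]; [:: 6; 7; 8; 9]; [:: 5; 7; 8; 9]; [:: 4; 6; 8; 9]; [::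
    5; 7; 9]; [:: 6; 8]; [:: 7]; [::]; [::]; [::]], Dominated 1 0, [:: (7, [::
    3; 1; 5; 2; 0; 4; 7; 6; 9; 8; 10]); (4, [:: 5; 2; 9; 4; 8; 0]); (7, [:: 4;
    1; 6; 2; 0; 3; 8; 5; 10; 7; 9]); (4, [:: 6; 2; 10; 3; 7; 0])]);
  ([:: [:: 6; 7; 8; 9]; [:: 5; 7; 8; 9]; [:: 3; 6; 8; 9]; [:: 5; 7; 9]; [:: 5;
    6; 7; 8; 9]; [:: 6; 8]; [:: 7]; [::]; [::]; [::]], Dominated 1 4, [:: (7,
    [:: 3; 0; 1; 6; 5; 8; 2; 10; 4; 9; 7]); (8, [:: 1; 3; 5; 0; 2; 6; 4; 8; 7;
    10; 9])]);
  ([:: [:: 3]; [:: 2; 4]; [:: 4]; [:: 4]; [::]], Twins 2 1, [:: (6, [:: 1; 0;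
    2; 4; 3; 5]); (6, [:: 1; 0; 3; 4; 2; 5]); (5, [:: 1; 2; 3; 5; 4; 0]); (3,
    [:: 1; 2; 3; 4; 5; 0]); (5, [:: 1; 3; 2; 5; 4; 0]); (3, [:: 1; 3; 2; 4; 5;
    0])]);
  ([:: [:: 5; 6; 7; 8]; [:: 4; 6; 7; 8]; [:: 3; 5; 7; 8]; [:: 4; 6; 8]; [:: 5;
    7]; [:: 6]; [::]; [::]; [::]], Component [:: (1, 0); (2, 0)], [:: (10, [::
    0; 1; 2; 3; 4; 5; 6; 7; 8; 9]); (10, [:: 0; 2; 1; 4; 3; 6; 5; 8; 7; 9]);
    (11, [:: 1; 2; 3; 4; 0; 5; 6; 7; 8; 9]); (10, [:: 0; 3; 1; 5; 2; 7; 4; 9;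
    6; 8]); (11, [:: 1; 3; 2; 5; 0; 4; 7; 6; 9; 8]); (4, [:: 1; 4; 5; 6; 9;
    0]); (10, [:: 0; 4; 2; 6; 1; 8; 3; 9; 5; 7]); (11, [:: 2; 4; 1; 6; 0; 3;
    8; 5; 9; 7]); (4, [:: 2; 3; 6; 5; 9; 0]); (10, [:: 0; 5; 3; 7; 1; 9; 2; 8;
    4; 6]); (11, [:: 3; 5; 1; 7; 0; 2; 9; 4; 8; 6]); (4, [:: 3; 2; 7; 4; 8;
    0]); (10, [:: 0; 6; 4; 8; 2; 9; 1; 7; 3; 5]); (11, [:: 4; 6; 2; 8; 0; 1;
    9; 3; 7; 5]); (4, [:: 4; 1; 8; 3; 7; 0]); (10, [:: 0; 7; 5; 9; 3; 8; 1; 6;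
    2; 4]); (11, [:: 5; 7; 3; 9; 0; 1; 8; 2; 6; 4]); (4, [:: 5; 1; 9; 2; 6;
    0]); (10, [:: 0; 8; 6; 9; 4; 7; 2; 5; 1; 3]); (11, [:: 6; 8; 4; 9; 0; 2;
    7; 1; 5; 3]); (4, [:: 6; 2; 9; 1; 5; 0]); (10, [:: 0; 9; 7; 8; 5; 6; 3; 4;
    1; 2]); (11, [:: 7; 9; 5; 8; 0; 3; 6; 1; 4; 2]); (4, [:: 7; 3; 8; 1; 4;
    0]); (11, [:: 8; 9; 6; 7; 0; 4; 5; 2; 3; 1]); (4, [:: 8; 4; 7; 1; 3; 0]);
    (4, [:: 9; 5; 6; 1; 2; 0])]);
  ([:: [:: 5; 6; 7; 8]; [:: 4; 6; 7; 8]; [:: 3; 5; 6; 8]; [:: 4; 6; 7]; [:: 5;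
    8]; [:: 7]; [::]; [:: 8]; [::]], Dominated 4 7, [:: (11, [:: 0; 6; 7; 4;
    9; 8; 2; 5; 1; 3]); (9, [:: 6; 7; 9; 0; 4; 8; 2; 5; 1; 3])]);
  ([:: [:: 5; 6; 7; 8]; [:: 4; 6; 7; 8]; [:: 3; 5; 7; 8]; [:: 4; 6; 8]; [:: 5;
    7]; [:: 6; 8]; [:: 7]; [::]; [::]], Dominated 4 6, [:: (9, [:: 0; 4; 8; 6;
    9; 2; 7; 1; 5; 3])]);
  ([:: [:: 5; 6]; [:: 4; 6]; [:: 3; 6]; [:: 6]; [:: 5; 6]; [:: 6]; [::]],
    Dominated 0 4, [:: (3, [:: 0; 2; 5; 1; 7; 6]); (4, [:: 0; 5; 6; 1; 2; 7]);
    (12, [:: 0; 3; 4; 1; 7]); (12, [:: 5; 3; 4; 2; 0])]);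
  ([:: [:: 4; 5]; [:: 4; 5]; [:: 3; 5]; [:: 5]; [:: 5]; [::]], Dominated 1 0,
    [:: (12, [:: 0; 3; 4; 2; 6]); (16, [:: 0; 1; 3; 4; 5; 2; 6]); (12, [:: 0;
    3; 4; 2; 6]); (12, [:: 1; 3; 4; 5; 0])]);
  ([:: [:: 5; 6; 7]; [:: 4; 6; 7]; [:: 3; 5; 6; 7]; [:: 4; 6; 7]; [:: 5; 7];
    [:: 6]; [::]; [::]], Dominated 0 2, [:: (15, [:: 3; 1; 5; 2; 0; 4; 7; 6;
    8])]);
  ([:: [:: 5; 6; 7]; [:: 4; 6; 7]; [:: 3; 5; 7]; [:: 4; 6; 7]; [:: 5; 7]; [::
    6]; [::]; [::]], Dominated 2 4, [:: (14, [:: 3; 5; 1; 7; 2; 0; 6; 4; 8]);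
    (15, [:: 3; 1; 5; 2; 7; 4; 0; 6; 8])]);
  ([:: [:: 5; 6; 7]; [:: 4; 6; 7]; [:: 3; 5; 7]; [:: 4; 6]; [:: 5; 7]; [:: 6];
    [::]; [::]], Dominated 2 4, [:: (12, [:: 1; 0; 3; 7; 4]); (13, [:: 0; 7;
    8; 5; 6; 3; 4; 1; 2]); (14, [:: 1; 3; 2; 5; 4; 7; 8; 6; 0]); (4, [:: 7; 3;
    8; 1; 4; 0])]);
  ([:: [:: 5; 6]; [:: 4; 6]; [:: 3; 5; 6]; [:: 4; 6]; [:: 5]; [::]; [::]],
    Dominated 0 2, [:: (12, [:: 2; 0; 1; 5; 6]); (20, [:: 1; 3; 2; 5; 4; 0; 6;
    7]); (4, [:: 5; 1; 7; 2; 6; 0])]);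
  ([:: [:: 5; 6]; [:: 4; 5; 6]; [:: 3; 5; 6]; [:: 4; 6]; [:: 5]; [::]; [::]],
    Dominated 0 2, [:: (12, [:: 4; 0; 1; 3; 6]); (20, [:: 3; 5; 1; 0; 2; 7; 4;
    6]); (19, [:: 3; 1; 5; 2; 0; 4; 7; 6]); (4, [:: 5; 1; 7; 4; 6; 0])]);
  ([:: [:: 4; 5; 6]; [:: 4; 5; 6]; [:: 3; 5; 6]; [:: 4; 6]; [:: 5]; [::];
    [::]], Dominated 1 0, [:: (19, [:: 3; 0; 1; 5; 2; 7; 4; 6]); (18, [:: 1;
    3; 2; 0; 4; 5; 6; 7]); (19, [:: 4; 0; 1; 6; 2; 7; 3; 5]); (18, [:: 1; 4;
    2; 0; 3; 6; 5; 7])]);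
  ([:: [:: 4; 5; 6]; [:: 3; 5; 6]; [:: 3; 4; 5; 6]; [:: 4; 6]; [:: 5]; [::];
    [::]], Dominated 1 2, [:: (4, [:: 0; 3; 7; 2; 5; 4]); (18, [:: 0; 1; 4; 3;
    6; 2; 7; 5])]);
  ([:: [:: 3; 4]; [:: 2; 4]; [:: 4]; [:: 4]; [::]], Twins 3 0, [:: (12, [:: 0;
    2; 3; 4; 5]); (17, [:: 0; 1; 2; 3; 4; 5]); (12, [:: 1; 2; 3; 4; 0]); (12,
    [:: 0; 2; 3; 1; 5]); (17, [:: 0; 4; 2; 3; 1; 5]); (12, [:: 4; 2; 3; 1;
    0])]);
  ([:: [:: 3; 4; 5]; [:: 2; 4; 5]; [:: 3; 5]; [:: 4]; [::]; [::]], Component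
    [:: (1, 0); (2, 0)], [:: (22, [:: 0; 1; 2; 3; 4; 5; 6]); (22, [:: 0; 1; 3;
    2; 5; 4; 6]); (23, [:: 0; 1; 2; 3; 4; 5; 6]); (22, [:: 0; 2; 4; 1; 6; 3;
    5]); (23, [:: 0; 2; 1; 4; 3; 6; 5]); (24, [:: 1; 2; 0; 3; 4; 5; 6]); (22,
    [:: 0; 3; 5; 1; 6; 2; 4]); (23, [:: 0; 3; 1; 5; 2; 6; 4]); (24, [:: 1; 3;
    0; 2; 5; 4; 6]); (22, [:: 0; 4; 6; 2; 5; 1; 3]); (23, [:: 0; 4; 2; 6; 1;
    5; 3]); (24, [:: 2; 4; 0; 1; 6; 3; 5]); (22, [:: 0; 5; 6; 3; 4; 1; 2]);
    (23, [:: 0; 5; 3; 6; 1; 4; 2]); (24, [:: 3; 5; 0; 1; 6; 2; 4]); (23, [::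
    0; 6; 4; 5; 2; 3; 1]); (24, [:: 4; 6; 0; 2; 5; 1; 3]); (24, [:: 5; 6; 0;
    3; 4; 1; 2])]);
  ([:: [:: 4; 5]; [:: 4; 5]; [:: 3; 5]; [:: 4]; [::]; [::]], Dominated 1 0,
    [:: (12, [:: 3; 0; 2; 4; 5]); (21, [:: 1; 3; 2; 0; 4; 5; 6]); (4, [:: 3;
    2; 5; 4; 6; 0]); (21, [:: 1; 4; 2; 0; 3; 6; 5]); (4, [:: 4; 2; 6; 3; 5;
    0])]);
  ([:: [:: 4; 5]; [:: 3; 5]; [:: 3; 4; 5]; [:: 4]; [::]; [::]], Dominated 0 2,
    [:: (12, [:: 2; 0; 1; 4; 5]); (21, [:: 0; 2; 5; 3; 6; 1; 4]); (22, [:: 2;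
    0; 3; 5; 1; 6; 4]); (4, [:: 2; 1; 5; 4; 6; 0])]);
  ([:: [:: 3; 4; 5]; [:: 2; 4; 5]; [:: 3; 5]; [:: 4]; [:: 5]; [::]], Dominated
    2 4, [:: (4, [:: 0; 2; 5; 1; 3; 6]); (24, [:: 0; 4; 6; 5; 2; 3; 1])]);
  ([:: [:: 3; 4]; [:: 2; 4]; [:: 3; 4]; [:: 4]; [::]], Dominated 1 3, [:: (3,
    [:: 0; 1; 4; 2; 5; 3]); (4, [:: 0; 3; 4; 1; 2; 5]); (29, [:: 2; 4; 1; 0;
    3; 5])]);
  ([:: [:: 3; 4]; [:: 2; 4]; [:: 3]; [::]; [::]], LowDegree 4, [:: (27, [:: 0;
    1; 2; 3; 4; 5]); (27, [:: 0; 2; 1; 4; 3; 5]); (28, [:: 1; 2; 0; 3; 4; 5]);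
    (28, [:: 1; 3; 0; 2; 5; 4]); (12, [:: 1; 0; 2; 4; 3]); (4, [:: 1; 2; 3; 4;
    5; 0]); (12, [:: 2; 0; 1; 3; 4]); (28, [:: 2; 4; 0; 1; 5; 3]); (4, [:: 2;
    1; 4; 3; 5; 0]); (12, [:: 3; 0; 5; 4; 1]); (4, [:: 3; 1; 5; 2; 4; 0]); (4,
    [:: 4; 2; 5; 1; 3; 0])]);
  ([:: [:: 3; 4]; [:: 2; 4]; [:: 3]; [:: 4]; [::]], Dominated 2 4, [:: (5, [::
    0; 1; 4; 5; 2; 3]); (12, [:: 1; 0; 3; 5; 2]); (28, [:: 0; 2; 4; 5; 1; 3]);
    (4, [:: 2; 0; 1; 5; 3; 4]); (26, [:: 0; 4; 5; 2; 3; 1]); (29, [:: 1; 3; 2;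
    5; 4; 0])]);
  ([:: [:: 3]; [:: 2]; [:: 3]; [::]], Dominated 0 2, [:: (12, [:: 2; 0; 1; 3;
    4]); (31, [:: 0; 3; 4; 1; 2]); (32, [:: 1; 2; 3; 4; 0])]);
  ([:: [:: 3]; [:: 2; 3]; [:: 3]; [::]], Dominated 0 2, [:: (12, [:: 0; 2; 3;
    1; 4]); (25, [:: 0; 2; 3; 1; 4]); (32, [:: 3; 0; 1; 4; 2]); (30, [:: 1; 3;
    2; 0; 4])]);
  ([:: [:: 2]; [:: 2]; [::]], Dominated 1 0, [:: (33, [:: 0; 1; 3; 2]); (34,
    [:: 1; 0; 2; 3])]);
  ([:: [:: 1]; [::]], Twins 1 0, [:: (35, [:: 0; 1; 2]); (35, [:: 0; 2; 1])]);
  ([:: [::]], LowDegree 0, [:: (36, [:: 0; 1])])].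

(** * Soundness of the certificate *)

Section Soundness.
Variables (G : sgraph) (f : {ffun G -> 'I_3}).
Hypotheses (minG : minimal_nonmixing G) (pf : proper_coloring f).

Fixpoint halfmatrix_on (vs : seq G) : halfmatrix :=
  if vs is v :: vs' then [seq adj v w | w <- vs'] :: halfmatrix_on vs' else [::].

Definition absent (M : halfmatrix) : Prop :=
  forall vs : seq G, uniq vs -> halfmatrix_on vs = M -> False.

Lemma size_halfmatrix_on vs : size (halfmatrix_on vs) = size vs.
Proof. by elim: vs => //= v vs ->. Qed.

Lemma entry_halfmatrix_on v0 vs i j : i < size vs -> j < size vs ->
  entry (halfmatrix_on vs) i j = adj (nth v0 vs i) (nth v0 vs j).
Proof.
wlog ij : i j / i <= j => [wl | ] ilt jlt.
  case: (leqP i j) => [/wl|/ltnW ji]; first exact.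
  rewrite adj_sym -wl // /entry; case: ltngtP => //.
rewrite /entry; move: ij; rewrite leq_eqVlt => /predU1P[-> | ij].
  by rewrite ltnn adj_irrefl.
rewrite ij; elim: vs i j ij ilt jlt => //= v vs IH [|i] [|j] //= ij ilt jlt.
  by rewrite subn1 /= (nth_map v0).
by rewrite subSS IH.
Qed.

Lemma submatrix_halfmatrix_on v0 vs t : all (ltn^~ (size vs)) t ->
  submatrix (halfmatrix_on vs) t = halfmatrix_on [seq nth v0 vs i | i <- t].
Proof.
elim: t => //= i t IH /andP[it tt]; rewrite IH //; congr cons.
rewrite -map_comp; apply/eq_in_map => j jt /=.
by rewrite (entry_halfmatrix_on v0) //; apply: (allP tt).
Qed.

Lemma colorings_complete k (c : {ffun G -> 'I_k}) vs : proper_coloring c ->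
  [seq val (c v) | v <- vs] \in colorings k (halfmatrix_on vs).
Proof.
move=> pc; elim: vs => //= v vs IH.
apply/flattenP; exists [seq x :: [seq val (c w) | w <- vs] | x <- iota 0 k
    & all2 (fun e y => e ==> (y != x)) [seq adj v w | w <- vs] [seq val (c w) | w <- vs]].
  by apply: map_f IH.
apply: map_f; rewrite mem_filter mem_iota leq0n add0n ltn_ord !andbT.
elim: vs {IH} => //= w vs ->; rewrite andbT; apply/implyP => vw.
by rewrite (inj_eq val_inj) eq_sym; move/proper_coloringP: pc; apply.
Qed.

Lemma mem_bitseqs e : e \in bitseqs (size e).
Proof. by elim: e => //= -[] e IH; rewrite mem_cat map_f ?orbT. Qed.

Section NewVertex.
Variables (vs : seq G) (v : G).
Let M := halfmatrix_on vs.
Let e := [seq adj v w | w <- vs].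

(** The three kinds of pattern place the new vertex second, first or in the middle of the path;
    reversed paths are covered because edges are listed in both directions. *)
Lemma p5_patterns_sound : ~~ has (matches e) (p5_patterns M).
Proof.
case: (minG) => _ free _ _; apply/hasPn => t.
have adjE i j : i \in iota 0 (size M) -> j \in iota 0 (size M) ->
    entry M i j = adj (nth v vs i) (nth v vs j).
  by rewrite !mem_iota size_halfmatrix_on; apply: entry_halfmatrix_on.
have newE i : i \in iota 0 (size M) -> nth false e i = adj v (nth v vs i).
  by rewrite mem_iota size_halfmatrix_on => ilt; rewrite (nth_map v).
have memE p : p \in flatten [seq [seq (i, j) | j <- iota 0 (size M) & entry M i j]
                            | i <- iota 0 (size M)] ->
    [/\ p.1 \in iota 0 (size M), p.2 \in iota 0 (size M)
      & adj (nth v vs p.1) (nth v vs p.2)].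
  case/flatten_mapP=> i iI /mapP[j]; rewrite mem_filter => /andP[ij jI] -> /=.
  by rewrite -adjE.
case/flatten_mapP=> -[a b] /memE[/= aI bI ab] /flatten_mapP[[c d] /memE[/= cI dI cd]].
have [bc | _] := eqVneq b c.
  subst c; case: ifP => // /norP[_]; rewrite adjE // => ad.
  case/mapP=> x; rewrite mem_filter => /andP[] /norP[+ /norP[+ +]] xI.
  rewrite !adjE // => xa xb xd -> /=; rewrite /matches /= !andbT !newE //.
  apply/negP => /andP[/andP[vx va] /andP[vb vd]].
  by apply: (free (nth v vs x) v (nth v vs a) (nth v vs b) (nth v vs d));
    rewrite // adj_sym.
case: ifP => // /norP[/norP[]]; rewrite !adjE // => ac ad bd.
case: ifP => bc; rewrite inE => /eqP->; rewrite /matches /= !andbT !newE //;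
    apply/negP.
  case/andP=> va /and3P[vb vc vd].
  by apply: (free v (nth v vs a) (nth v vs b) (nth v vs c) (nth v vs d)).
case/andP=> /andP[va vc] /andP[vb vd].
apply: (free (nth v vs b) (nth v vs a) v (nth v vs c) (nth v vs d)) => //;
  by rewrite ?bc // adj_sym.
Qed.

Lemma extensions_complete r : demands r e -> e \in extensions M r.
Proof.
move=> re; rewrite /extensions; cbv zeta; rewrite mem_filter re p5_patterns_sound /=.
have -> : size M = size e by rewrite size_halfmatrix_on size_map.
rewrite mem_bitseqs andbT; apply/hasP.
have /flatten_mapP[c cC] : [seq val (f w) | w <- v :: vs] \in
    flatten [seq [seq x :: c | x <- iota 0 3 & all2 (fun b y => b ==> (y != x)) e c]
            | c <- colorings 3 M] := colorings_complete (v :: vs) pf.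
case/mapP=> x; rewrite mem_filter => /andP[xc xI] _.
exists c; [exact: cC | have : has (fun x => all2 (fun b y => b ==> (y != x)) e c) (iota 0 3) by apply/hasP; exists x]; exact.
Qed.

End NewVertex.

Lemma neighbors_on v0 (vs : seq G) i w : uniq vs -> i < size vs ->
  (forall w, adj (nth v0 vs i) w -> w \in vs) ->
  adj (nth v0 vs i) w ->
  exists2 j, j \in neighbors (halfmatrix_on vs) i & w = nth v0 vs j.
Proof.
move=> uvs ilt closed iw; have wv := closed w iw.
exists (index w vs); last by rewrite nth_index.
rewrite mem_filter mem_iota leq0n size_halfmatrix_on index_mem wv !andbT.
by rewrite (entry_halfmatrix_on v0) ?index_mem // nth_index.
Qed.

(** As [vs] is closed under adjacency, the coded graph sees all neighbours of its vertices, so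
    recolourings allowed in the code are allowed in [G]. *)
Lemma mergeable_sound v0 (vs : seq G) i j : uniq vs ->
  (forall v w, v \in vs -> adj v w -> w \in vs) ->
  mergeable (halfmatrix_on vs) i j -> f (nth v0 vs i) = f (nth v0 vs j) -> False.
Proof.
move=> uvs closed; rewrite /mergeable; cbv zeta; rewrite size_halfmatrix_on.
case/and5P=> ilt jlt ij link moves fij.
set x := nth v0 vs i in fij; set y := nth v0 vs j in fij.
have xy : x != y by rewrite nth_uniq.
have nbE k : k < size vs ->
    nth [::] [seq neighbors (halfmatrix_on vs) v | v <- iota 0 (size vs)] k =
    neighbors (halfmatrix_on vs) k.
  by move=> klt; rewrite (nth_map 0) ?size_iota // nth_iota.
have nbP k w : k < size vs -> adj (nth v0 vs k) w ->
    exists l, [/\ l < size vs, l \in neighbors (halfmatrix_on vs) k & w = nth v0 vs l].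
  move=> klt kw; have [l lk ->] := neighbors_on uvs klt (closed _ ^~ (mem_nth _ klt)) kw.
  exists l; split=> //; by move: lk; rewrite mem_filter mem_iota size_halfmatrix_on => /andP[].
have nbA k l : k < size vs -> l \in neighbors (halfmatrix_on vs) k ->
    adj (nth v0 vs k) (nth v0 vs l).
  move=> klt; rewrite mem_filter mem_iota size_halfmatrix_on => /andP[+ llt].
  by rewrite (entry_halfmatrix_on v0).
have nxy : ~~ adj x y.
  by apply: contraTN isT => /(proper_coloringP _ pf); rewrite fij eqxx.
apply: (@minimal_contraction G [set x; y] f x y minG) => //; rewrite ?inE ?eqxx ?orbT //.
- by rewrite eq_sym.
- by move=> u v /set2P[]-> /set2P[]->.
- have link' p q : adj x p -> adj y q -> ~~ adj p q -> adj y p \/ adj x q.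
    move=> xp yq pq.
    have [k [klt ki pk]] := nbP i p ilt xp; have [l [llt lj ql]] := nbP j q jlt yq.
    move: link; rewrite !nbE // => /allP/(_ k ki)/orP[kj | /allP/(_ l lj)/orP[li |]].
    + by left; rewrite pk nbA.
    + by right; rewrite ql nbA.
    + by rewrite (entry_halfmatrix_on v0) // -pk -ql (negPf pq).
  have both p q n : n \in [set x; y] -> adj n p -> adj n q ->
      exists2 n, n \in [set x; y] & adj n p && adj n q.
    by move=> nN np nq; exists n => //; rewrite np.
  move=> p q /exists_inP[n nN np] /exists_inP[m mN mq] pq.
  case/set2P: (nN) np => -> np; case/set2P: (mN) mq => -> mq.
  + by apply: (both p q x); rewrite ?inE ?eqxx.
  + case: (link' p q) => // h; first by apply: (both p q y); rewrite ?inE ?eqxx ?orbT.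
    by apply: (both p q x); rewrite ?inE ?eqxx.
  + case: (link' q p) => //; first by rewrite adj_sym.
      by move=> h; apply: (both p q y); rewrite ?inE ?eqxx ?orbT.
    by move=> h; apply: (both p q x); rewrite ?inE ?eqxx.
  + by apply: (both p q y); rewrite ?inE ?eqxx ?orbT.
- move=> c pc.
  pose code (d : {ffun G -> 'I_4}) := [seq val (d v) | v <- vs].
  have codeE d k : k < size vs -> nth 0 (code d) k = d (nth v0 vs k).
    by move=> klt; rewrite (nth_map v0).
  have merged1 (d : {ffun G -> 'I_4}) : proper_coloring d -> d x = d y ->
      exists2 d', reach d d' & forall u v, u \in [set x; y] -> v \in [set x; y] -> d' u = d' v.
    move=> pd dxy; exists d; first exact: connect0.
    by move=> u v /set2P[]-> /set2P[]->.
  have allowedP d k (z : 'I_4) : k < size vs -> proper_coloring d ->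
      all (fun w => nth 0 (code d) w != z) (neighbors (halfmatrix_on vs) k) ->
      reach d (recolor d [set nth v0 vs k] z).
    move=> klt pd /allP h; apply: recolor1_reach => // w /(nbP _ _ klt)[l [llt lk ->]].
    by have := h l lk; rewrite codeE.
  have direct d : proper_coloring d ->
      [|| nth 0 (code d) i == nth 0 (code d) j,
          all (fun w => nth 0 (code d) w != nth 0 (code d) j) (neighbors (halfmatrix_on vs) i)
        | all (fun w => nth 0 (code d) w != nth 0 (code d) i) (neighbors (halfmatrix_on vs) j)] ->
      exists2 d', reach d d' & forall u v, u \in [set x; y] -> v \in [set x; y] -> d' u = d' v.
    move=> pd; rewrite [nth 0 _ j]codeE // [nth 0 _ i]codeE // => /or3P[/eqP/val_inj|h|h].
    + exact: merged1.
    + have r := allowedP d i (d y) ilt pd h.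
      have [|d' r' d'N] := merged1 _ (reach_proper r pd); last first.
        by exists d' => //; apply: reach_trans r r'.
      by rewrite !ffunE !inE eqxx eq_sym (negPf xy).
    + have r := allowedP d j (d x) jlt pd h.
      have [|d' r' d'N] := merged1 _ (reach_proper r pd); last first.
        by exists d' => //; apply: reach_trans r r'.
      by rewrite !ffunE !inE eqxx (negPf xy).
  (* The exhaustive check is applied to the code of [c]: the pair merges directly, or after
     recolouring vertex [k] with [z]. *)
  move/allP/(_ _ (colorings_complete vs pc)): moves.
  rewrite -/(code c) !nbE // => /orP[/(direct c pc) // |].
  case/hasP=> k; rewrite mem_iota => klt /hasP[z]; rewrite mem_iota => zlt.
  rewrite nbE // => /andP[al].
  have r := allowedP c k (Ordinal zlt) klt pc al.
  have -> : set_nth 0 (code c) k z = code (recolor c [set nth v0 vs k] (Ordinal zlt)).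
    apply: (@eq_from_nth _ 0) => [|l]; rewrite size_set_nth !size_map.
      by apply/maxn_idPr.
    rewrite (maxn_idPr klt) => llt; rewrite nth_set_nth /= !codeE // ffunE inE nth_uniq //.
    by case: ifP.
  case/direct; first exact: reach_proper r pc.
  by move=> d r' dN; exists d => //; apply: reach_trans r r'.
Qed.

(* [demands] speaks about a vertex outside [vs]; the rules make sure that the
   vertex provided by minimality is not in [vs]. *)
Lemma applicable_sound r (vs : seq G) : uniq vs ->
  applicable r (halfmatrix_on vs) ->
  exists2 v, v \notin vs & demands r [seq adj v w | w <- vs].
Proof.
(* No rule applies to the empty graph, since each one needs an index below the size; this supplies a
   default vertex for [nth]. *)
move=> uvs app; have vs0 : 0 < size vs.
  move: app; rewrite -size_halfmatrix_on.
  case: r => [u v | u | u v | s]; rewrite /applicable; cbv zeta.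
  - by case/andP=> /(leq_ltn_trans (leq0n u)).
  - by case/andP=> /(leq_ltn_trans (leq0n u)).
  - by case/andP=> /(leq_ltn_trans (leq0n u)).
  - move/allP/(_ _ (colorings_complete vs pf))/hasP=> [[i j]].
    by rewrite mem_filter => /andP[/andP[/(leq_ltn_trans (leq0n i))]].
have [v0 v0vs] : exists v0, v0 \in vs.
  by case: vs vs0 {uvs app} => // v vs _; exists v; apply: mem_head.
have nthP i : i < size vs -> nth v0 vs i \in vs by apply: mem_nth.
have newE i v : i < size vs -> nth false [seq adj v w | w <- vs] i = adj v (nth v0 vs i).
  exact: nth_map.
have entE i j : i < size vs -> j < size vs ->
    entry (halfmatrix_on vs) i j = adj (nth v0 vs i) (nth v0 vs j).
  exact: entry_halfmatrix_on.
have allE P w : all P (iota 0 (size vs)) -> w \in vs -> P (index w vs) /\ index w vs < size vs.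
  by move=> /allP h wv; split; rewrite ?h ?mem_iota ?index_mem.
case: r app => [u v | u | u v | s]; rewrite /applicable; cbv zeta; rewrite ?size_halfmatrix_on.
- case/and4P=> ult vlt uv dom.
  have [w uw vw] : exists2 w, adj (nth v0 vs u) w & ~~ adj (nth v0 vs v) w.
    by apply: minimal_incomparable; rewrite ?nth_uniq.
  exists w; last by rewrite /= !newE // adj_sym uw adj_sym vw.
  apply/negP => wv; have [h ilt] := allE _ _ dom wv.
  by move: h; rewrite !entE // !nth_index // uw (negPf vw).
- case/andP=> ult deg.
  have [w uw wv] : exists2 w, adj (nth v0 vs u) w & w \notin vs.
    have [w /andP[uw wv] | nout] :=
      pickP [pred w | adj (nth v0 vs u) w & w \notin vs]; first by exists w.
    have := minimal_degree minG (nth v0 vs u); rewrite ltnNge => /negP[].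
    apply: leq_trans deg; rewrite -size_filter.
    have /subset_leq_card h : [set w | adj (nth v0 vs u) w] \subset
        [seq nth v0 vs i | i <- iota 0 (size vs) & entry (halfmatrix_on vs) u i].
      apply/subsetP => w; rewrite inE => uw.
      have wv : w \in vs by move: (nout w); rewrite /= uw => /negbFE.
      apply/mapP; exists (index w vs); last by rewrite nth_index.
      by rewrite mem_filter mem_iota index_mem wv entE ?index_mem // nth_index ?uw.
    by apply: leq_trans h _; apply: leq_trans (card_size _) _; rewrite size_map.
  by exists w => //=; rewrite newE // adj_sym.
- case/and4P=> ult vlt uv tw.
  have [|h] := boolP [exists w, [&& w \notin vs &
      adj (nth v0 vs u) w != adj (nth v0 vs v) w]].
    case/existsP=> w /andP[wv ne]; exists w => //=.
    by rewrite !newE // ![adj w _]adj_sym.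
  case: (@minimal_no_twins G f (nth v0 vs u) (nth v0 vs v)) => //.
    by rewrite -entE.
  move=> w wu wv; have [wvs | wvs] := boolP (w \in vs); last first.
    by move/existsPn/(_ w): h; rewrite wvs negbK => /eqP.
  have [/or3P[/eqP e|/eqP e|/eqP]] := allE _ _ tw wvs.
  + by move: wu; rewrite -e nth_index ?eqxx.
  + by move: wv; rewrite -e nth_index ?eqxx.
  + by rewrite !entE ?index_mem // nth_index.
(* Without an outside neighbour [vs] would be closed under adjacency, and a mergeable pair on which
   [f] is constant would contradict minimality. *)
- move=> merge; have [v /andP[vvs vN] | nout] :=
      pickP [pred v | v \notin vs & has id [seq adj v w | w <- vs]]; first by exists v.
  have closed v w : v \in vs -> adj v w -> w \in vs.
    move=> vvs vw; apply/negPn/negP => wvs; move: (nout w); rewrite /= wvs /= => /hasP[].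
    by exists true => //; apply/mapP; exists v; rewrite // adj_sym.
  case/allP/(_ _ (colorings_complete vs pf))/hasP: merge => -[i j].
  rewrite mem_filter => /andP[mij _] /= /eqP fij.
  have [ilt jlt] : i < size vs /\ j < size vs.
    by case/and5P: mij; rewrite size_halfmatrix_on.
  case: (mergeable_sound (v0 := v0) uvs closed mij); apply: val_inj.
  by rewrite !(nth_map v0) in fij.
Qed.

Lemma absent_extensions M r vs : uniq vs -> halfmatrix_on vs = M ->
  applicable r M ->
  (forall e, e \in extensions M r -> absent (e :: M)) -> False.
Proof.
move=> uvs eM app ext; have [|v vvs dem] := @applicable_sound r vs uvs.
  by rewrite eM.
apply: (ext [seq adj v w | w <- vs] _ (v :: vs)); rewrite /= ?vvs ?eM //.
by rewrite -eM; apply: extensions_complete.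
Qed.

(** A copy of a listed graph would grow, by its rule, into one of its extensions, and each of these
    contains a graph already shown to be absent. *)
Lemma certified_sound D L : (forall M, M \in D -> absent M) -> certified D L ->
  forall M, M \in [seq halfmatrix_of p.1.1 | p <- L] -> absent M.
Proof.
elim: L D => [|[[s r] K] L IH] D absD; first by [].
rewrite [certified D _]/=; cbv zeta; set M := halfmatrix_of s.
case/and4P=> app /eqP sizeK /allP ext cert.
have absM : absent M.
  move=> vs uvs eM; apply: (@absent_extensions M r vs) => // e eX ws uws ews.
  have v0 : G by case: ws ews {uws} => // w ws _.
  pose i := index e (extensions M r).
  have ilt : i < size (extensions M r) by rewrite index_mem.
  have : (e, nth (0, [::]) K i) \in zip (extensions M r) K.
    rewrite -{1}(nth_index [::] eX) -nth_zip ?sizeK // mem_nth //.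
    by rewrite size_zip sizeK minnn.
  move/ext; case: (nth _ K i) => k t /and4P[kD ut tlt /eqP sub].
  have sws : size ws = (size M).+1 by rewrite -(size_halfmatrix_on ws) ews.
  apply: (absD _ (mem_nth [::] kD) [seq nth v0 ws l | l <- t]).
    rewrite map_inj_in_uniq // => x y xt yt /eqP.
    by rewrite nth_uniq ?sws ?(allP tlt) // => /eqP.
  by rewrite -submatrix_halfmatrix_on ?sws // ews.
move=> M1; rewrite inE => /predU1P[-> // | ]; apply: (IH (rcons D M)) => //.
by move=> M2; rewrite mem_rcons inE => /predU1P[-> | /absD].
Qed.

End Soundness.

Lemma certificate_certified : certified [::] certificate.
Proof. by lazy. Qed.

Lemma no_minimal_nonmixing (G : sgraph) : ~ minimal_nonmixing G.
Proof.
move=> minG; case: (minG) => /colorableP[f pf] _ nmix _; apply: nmix.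
move=> c d _ _; have [v _ | G0] := pickP (@predT G); last first.
  have -> : c = d by apply/ffunP => v; have := G0 v.
  exact: connect0.
(* The one-vertex graph is among the excluded ones, yet any vertex [v] is a copy of it. *)
have single : [:: [::]] \in [seq halfmatrix_of p.1.1 | p <- certificate] by [].
by case: (certified_sound minG pf _ certificate_certified single (vs := [:: v])).
Qed.

Lemma widen_ord_inj m n (le_mn : m <= n) : injective (widen_ord le_mn).
Proof. by move=> x y /(congr1 val) /= /val_inj. Qed.

(** * Mixing with at least four colours *)

(** Makes [mix] decidable, so that the induction on the number of vertices can argue by
    contradiction. *)
Lemma mixP (G : sgraph) k : reflect (mix G k)
  [forall c : {ffun G -> 'I_k}, forall d : {ffun G -> 'I_k},
    proper_coloring c ==> (proper_coloring d ==> reach c d)].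
Proof.
apply: (iffP forallP) => [h c d pc pd | h c].
  by move/forallP/(_ d): (h c); rewrite pc pd.
by apply/forallP => d; apply/implyP => pc; apply/implyP; apply: h.
Qed.

Lemma p5free_mix4 (G : sgraph) : colorable G 3 -> p5free G -> mix G 4.
Proof.
move: {2}#|G|.+1 (ltnSn #|G|) => n; elim: n G => // n IH G; rewrite ltnS => leG col free.
have [//|nmix] := mixP G 4; case: (@no_minimal_nonmixing G); split=> // H ltH.
exact: (IH H (leq_trans ltH leG)).
Qed.

Lemma proper_inj (G : sgraph) k k' (h : 'I_k -> 'I_k') (c : {ffun G -> 'I_k}) :
  injective h -> proper_coloring c -> proper_coloring [ffun x => h (c x)].
Proof.
move=> hI /proper_coloringP pc; apply/proper_coloringP => x y xy.
by rewrite !ffunE (inj_eq hI) pc.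
Qed.

Lemma reach_inj (G : sgraph) k k' (h : 'I_k -> 'I_k') (c d : {ffun G -> 'I_k}) :
  injective h -> proper_coloring c -> reach c d ->
  reach [ffun x => h (c x)] [ffun x => h (d x)].
Proof.
move=> hI pc rcd.
have [||e re [_ ee]] := @reach_simulation G G k' k
    (fun c e => proper_coloring e /\ e = [ffun x => h (c x)]) _ c d
    [ffun x => h (c x)] rcd; last first.
- by rewrite ee in re.
- by split; [exact: proper_inj | reflexivity].
move=> g v x e pg pg' [pe ->].
have eE : [ffun y => h (recolor g [set v] x y)] =
    recolor [ffun y => h (g y)] [set v] (h x).
  by apply/ffunP => y; rewrite !ffunE; case: ifP.
exists [ffun y => h (recolor g [set v] x y)]; last by split=> //; apply: proper_inj.
rewrite eE; apply: recolor1_reach; first exact: proper_inj.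
move=> w vw; rewrite ffunE (inj_eq hI).
move/proper_coloringP/(_ v w vw): pg'; rewrite !ffunE !inE eqxx eq_sym.
by case: ifP => // /eqP e'; move: vw; rewrite e' adj_irrefl.
Qed.

(* The vertices of the last colour are frozen while the rest is brought to a
   3-colouring; then a colour other than the last one becomes free for them. *)
Lemma mix_succ k : 4 <= k ->
  (forall G, colorable G 3 -> p5free G -> mix G k) ->
  forall G, colorable G 3 -> p5free G -> mix G k.+1.
Proof.
move=> k4 mixk G col free; have k3 : 3 <= k := ltnW k4.
have [f pf] := colorableP _ _ col.
pose wide := widen_ord (leqnSn k).
have wideI : injective wide by exact: widen_ord_inj.
pose small3 (x : 'I_3) : 'I_k := widen_ord k3 x.
have small3I : injective small3 by exact: widen_ord_inj.
have k0 : 0 < k := leq_trans (isT : 0 < 4) k4.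
(* The default 0 is never relevant: [low] is only applied to colours below [k]. *)
pose low (x : 'I_k.+1) : 'I_k := insubd (Ordinal k0) (val x).
have lowK (x : 'I_k.+1) : x < k -> wide (low x) = x.
  by move=> xk; apply: val_inj; rewrite /= val_insubd xk.
(* It suffices to connect every colouring to one fixed target, the 3-colouring [f]. *)
suff main (c : {ffun G -> 'I_k.+1}) : proper_coloring c ->
    reach c [ffun x => wide (small3 (f x))].
  by move=> c d pc pd; apply: reach_trans (main c pc) _; rewrite reach_sym main.
move=> pc; pose C := [set x | c x == ord_max]; pose H := induced (~: C).
have notC (x : H) : val x \notin C by have := valP x; rewrite inE.
have c_lt x : x \notin C -> c x < k.
  by rewrite inE -val_eqE /= => ne; rewrite ltn_neqAle ne -ltnS ltn_ord.
pose g0 : {ffun H -> 'I_k} := [ffun x : H => low (c (val x))].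
pose g1 : {ffun H -> 'I_k} := [ffun x : H => small3 (f (val x))].
have pg0 : proper_coloring g0.
  apply/proper_coloringP => x y xy; rewrite !ffunE.
  rewrite -(inj_eq wideI) !lowK ?c_lt //.
  by move/proper_coloringP: pc; apply.
have pg1 : proper_coloring g1.
  apply/proper_coloringP => x y xy; rewrite !ffunE (inj_eq small3I).
  by move/proper_coloringP: pf; apply.
have mixH : mix H k.
  by apply: mixk; [exact: colorable_induced | exact: p5free_induced].
pose R (g : {ffun H -> 'I_k}) (d : {ffun G -> 'I_k.+1}) :=
  [/\ proper_coloring d, forall x : H, d (val x) = wide (g x)
    & forall x, x \in C -> d x = ord_max].
have [||d rd [pd dg dC]] := @reach_simulation G H k.+1 k R _ _ _ c (mixH _ _ pg0 pg1).
- move=> g v x d pg pg' [pd dg dC].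
  have r : reach d (recolor d [set val v] (wide x)).
    apply: recolor1_reach => // w vw; have [wC | wC] := boolP (w \in C).
      by rewrite dC // -val_eqE /= gtn_eqF.
    have wS : w \in ~: C by rewrite inE.
    move/proper_coloringP/(_ v (Sub w wS) vw): pg'; rewrite !ffunE !inE eqxx.
    case: ifP => [/eqP e | _]; first by move: vw; rewrite -e adj_irrefl.
    by rewrite -(inj_eq wideI) -dg eq_sym.
  exists (recolor d [set val v] (wide x)) => //; split.
  + exact: reach_proper r pd.
  + by move=> y; rewrite !ffunE !inE (inj_eq val_inj) dg; case: ifP.
  + move=> y yC; rewrite ffunE inE dC //; case: eqP => // e.
    by move: yC; rewrite e (negPf (notC v)).
- split=> // [x | x]; first by rewrite ffunE lowK // c_lt.
  by rewrite inE => /eqP.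
have dlt x : x \notin C -> d x < 3.
  move=> xC; have xS : x \in ~: C by rewrite inE.
  by rewrite -[x]/(val (Sub x xS : H)) dg ffunE /=.
(* Outside [C] only the colours 0, 1, 2 are now in use, so colour 3 is free for [C]; it differs from
   the last colour because [k] is at least 4. *)
pose three : 'I_k.+1 := Ordinal (ltnW k4 : 3 < k.+1).
have rd2 : reach d (recolor d C three).
  apply: recolor_reach => // v w vC vw.
  have wC : w \notin C.
    apply/negP => wC; move/proper_coloringP/(_ v w vw): pd.
    by rewrite !dC // eqxx.
  by rewrite wC -val_eqE /= ltn_eqF // dlt.
have pd2 := reach_proper rd2 pd.
apply: reach_trans rd (reach_trans rd2 _).
have d2lt x : recolor d C three x < k.
  by rewrite ffunE; case: ifPn => // /dlt; move=> h; apply: leq_trans h k3.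
(* The last colour is no longer used, so the rest of the way is a recolouring of the whole of [G]
   with [k] colours. *)
pose e : {ffun G -> 'I_k} := [ffun x => low (recolor d C three x)].
have eE : recolor d C three = [ffun x => wide (e x)].
  by apply/ffunP => x; rewrite [RHS]ffunE [e x]ffunE lowK.
have pe : proper_coloring e.
  apply/proper_coloringP => x y xy; rewrite ![e _]ffunE -(inj_eq wideI) !lowK //.
  by move/proper_coloringP: pd2; apply.
have -> : [ffun x => wide (small3 (f x))] =
    [ffun x => wide ([ffun y => small3 (f y)] x)].
  by apply/ffunP => x; rewrite !ffunE.
rewrite eE; apply: reach_inj => //; apply: mixk => //; exact: proper_inj.
Qed.

Lemma p5free_mix k (G : sgraph) : 4 <= k -> colorable G 3 -> p5free G -> mix G k.
Proof.
move=> k4; rewrite -(subnKC k4); elim: (k - 4) G => [|n IH] G; first exact: p5free_mix4.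
by rewrite addnS; apply: mix_succ => //; apply: leq_addr.
Qed.

(** * Induced paths and the reconfiguration graph *)

Lemma path_free5 (G : sgraph) : path_free 5 G -> p5free G.
Proof.
move=> free a b c d e ab bc cd de ac ad ae bd be ce.
pose s := [:: a; b; c; d; e].
have sep (x y z : G) : adj x z -> ~~ adj y z -> x != y.
  by move=> xz; apply: contraNneq => <-.
have ed : adj e d by rewrite adj_sym.
have us : uniq s.
  rewrite /= !inE !negb_or (adj_neq ab) (adj_neq bc) (adj_neq cd) (adj_neq de) /=.
  rewrite (eq_sym a c) (eq_sym a d) (eq_sym a e) (eq_sym b d) (eq_sym b e).
  rewrite (sep c a d) // (sep d a e) // (sep e a d) // (sep d b e) // (sep e b d) //=.
  by rewrite andbT; apply: (sep c e b); rewrite adj_sym.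
have table i j : i < 5 -> j < 5 ->
    adj (nth a s i) (nth a s j) = (i.+1 == j) || (j.+1 == i).
  pose E := (adj_irrefl, ab, bc, cd, de,
    negPf ac, negPf ad, negPf ae, negPf bd, negPf be, negPf ce).
  by move: i j => [|[|[|[|[|//]]]]] [|[|[|[|[|//]]]]] //= _ _; rewrite ?E // adj_sym E.
have [] := free [set x in s].
have mem (x : induced [set x in s]) : val x \in s.
  by have := valP x; rewrite inE.
have lts (x : induced [set x in s]) : index (val x) s < 5 by rewrite index_mem mem.
(* The isomorphism sends a vertex to its position on the path; injectivity and a count give
   bijectivity. *)
exists (fun x => Ordinal (lts x) : path_graph 5).
  apply: inj_card_bij => [x y exy | ]; last first.
    by rewrite card_ord card_induced cardsE; exact: (eq_leq (esym (card_uniqP us))).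
  have {}exy : index (val x) s = index (val y) s := congr1 val exy.
  by apply: val_inj; rewrite -(nth_index a (mem x)) exy nth_index.
move=> x y; have := table (index (val x) s) (index (val y) s) (lts x) (lts y).
by rewrite !nth_index // => xy; rewrite /adj /= /path_adj /= -/s -xy.
Qed.

(** Idle steps are skipped; any other step changes exactly one vertex and is an edge of the
    reconfiguration graph. *)
Lemma reach_connect (G : sgraph) k (c d : reconf_graph G k) :
  reach (val c) (val d) -> connect (@adj (reconf_graph G k)) c d.
Proof.
case/connectP=> p; elim: p c => [|e p IH] c /= => [_ /val_inj -> | ].
  exact: connect0.
case/andP=> /and3P[pc pe /existsP[v /eqP ev]] hp hl.
apply: connect_trans (IH (Sub e pe) hp hl).
have [eq_v | neq_v] := eqVneq (val c v) (e v).
  suff -> : c = Sub e pe by exact: connect0.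
  apply: val_inj; apply/ffunP => w /=; rewrite ev ffunE inE.
  by case: ifP => // /eqP->.
apply: connect1; rewrite /adj /= /reconf_adj /=.
apply/cards1P; exists v; apply/setP => w; rewrite !inE ev ffunE inE.
by case: ifP => [/eqP-> | _]; rewrite ?neq_v ?eqxx.
Qed.

Theorem theorem1p6 (G : sgraph) (chiG : chromatic_number G = 3)
    (freeG : path_free 5 G) (k : nat) (hk : 4 <= k) :
  connected_graph (reconf_graph G k).
Proof.
have col : colorable G 3 by move: chiG; rewrite /chromatic_number; case: ex_minnP => m cm _ <-.
have free := path_free5 freeG; split.
  have [f pf] := colorableP _ _ col; apply/card_gt0P.
  by exists (Sub _ (proper_inj (widen_ord_inj (le_mn := ltnW hk)) pf)).
move=> c d; apply: reach_connect; apply: p5free_mix => //; exact: valP.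
Qed.
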